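(* Let $p(y,s,m)=p(m)\prod_{k=1}^K p(y_k,s_k\mid m_k=1)^{m_k}$ be a mixture of $K$ models, each represented by a Forney-style factor graph, with observations $y=\hat y$. Assume that the individual models are acyclic and tractable (they submit to exact inference). Let $s_j$ be a latent variable in the overlap of all models which connects the overlapping factors to the non-overlapping factors. On the edge of $s_j$ the $k$-th model has sum-product messages $\vec\mu_{s_j\mid m_k=1}(s_j)$ and $\overleftarrow{\mu}_{s_j\mid m_k=1}(s_j)$. Because $s_j$ lies in the overlapping model section, one of these two is independent of the model; take it to be the backward one, so that $\overleftarrow{\mu}_{s_j\mid m_k=1}(s_j)=\overleftarrow{\mu}_{s_j}(s_j)$ for all $k$. Consider the mixture node that connects the edge of $m$ and the edges of $s_j\mid m_k=1$, $k=1,\dots,K$, to the edge of $s_j$ marginalized over $m$. Let $\vec\mu_m(m)$ denote the message towards $m$ that does not originate from $f_m$, where $f_m(m)=\prod_{k=1}^K\exp(-\mathrm F_k[q])^{m_k}$. Then the outgoing messages of the mixture node are $$\overleftarrow{\mu}_m(m)=\prod_{k=1}^K\left(\int\vec\mu_{s_j\mid m_k=1}(s_j)\,\overleftarrow{\mu}_{s_j}(s_j)\,\mathrm ds_j\right)^{m_k},\qquad \vec\mu_{s_j}(s_j)=\sum_{k=1}^K\vec\mu_m(m_k=1)\,\vec\mu_{s_j\mid m_k=1}(s_j),\qquad \overleftarrow{\mu}_{s_j\mid m_k=1}(s_j)=\overleftarrow{\mu}_{s_j}(s_j),$$ in the following sense. (i) For each $k$, $\exp(-\mathrm F_k[q])=\int\vec\mu_{s_j\mid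 m_k=1}(s_j)\,\overleftarrow{\mu}_{s_j\mid m_k=1}(s_j)\,\mathrm ds_j$. Hence $\overleftarrow{\mu}_m(m)=f_m(m)$. The posterior $q(m)$ obtained by functional optimization of the variational free energy $\mathrm F[q]$ satisfies $q(m)\propto\vec\mu_m(m)\,\overleftarrow{\mu}_m(m)=\vec\mu_m(m)\,f_m(m)$. (ii) With $Z_m=\sum_{k=1}^K\vec\mu_m(m_k=1)\,\overleftarrow{\mu}_m(m_k=1)$, the posterior of $s_j$ marginalized over the models, $q(s_j)=\mathbb E_{q(m)}\left[\prod_{k=1}^K q(s_j\mid m_k=1)^{m_k}\right]$, satisfies $$Z_m\,q(s_j)=\left(\sum_{k=1}^K\vec\mu_m(m_k=1)\,\vec\mu_{s_j\mid m_k=1}(s_j)\right)\overleftarrow{\mu}_{s_j}(s_j)=\vec\mu_{s_j}(s_j)\,\overleftarrow{\mu}_{s_j}(s_j).$$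
   Context: The model selection variable $m=(m_1,\dots,m_K)$ is a one-of-$K$ binary vector ($m_k\in\{0,1\}$, $\sum_k m_k=1$); for a function $g$ of $m$, $g(m_k=1)$ denotes its value at the $k$-th one-hot vector. The $k$-th normalized model $p(y_k,s_k\mid m_k=1)$ has observed variables $y_k$ and latent variables $s_k$, with $y=\bigcup_k y_k$, $s=\bigcup_k s_k$. Overlapping factors are those present in all $K$ models; overlapping latent variables are those in $\bigcap_k s_k$. The prior $p(m)$ has its own graph, possibly hierarchical or temporal with additional latent variables, and $\vec\mu_m(m)$ arrives from it; in the simplest case it is the message of the prior $p(m)$. Free energies: $\mathrm F_k[q]=\mathbb E_{q(s_k\mid m_k=1)}\left[\ln\frac{q(s_k\mid m_k=1)}{p(y_k=\hat y_k,s_k\mid m_k=1)}\right]$ is the variational free energy of the $k$-th model, and for $q(s,m)=q(m)\prod_k q(s_k\mid m_k=1)^{m_k}$, $\mathrm F[q]=\mathbb E_{q(s,m)}\left[\ln\frac{q(s,m)}{p(y=\hat y,s,m)}\right]=\mathbb E_{q(m)}\left[\ln\frac{q(m)}{p(m)f_m(m)}\right]$. Under exact inference $q(s_k\mid m_k=1)$ is the exact posterior $p(s_k\mid y_k=\hat y_k,m_k=1)$, and its marginal on $s_j$ is $q(s_j\mid m_k=1)=\vec\mu_{s_j\mid m_k=1}(s_j)\overleftarrow{\mu}_{s_j\mid m_k=1}(s_j)\big/\int\vec\mu_{s_j\mid m_k=1}(s_j)\overleftarrow{\mu}_{s_j\mid m_k=1}(s_j)\,\mathrm ds_j$. Forney-style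 factor graph: for a model $\prod_a f_a(y_a,s_a)$, nodes are factors and edges are variables, an edge being connected to a node only if its variable is an argument of that factor; observed variables are fixed to $\hat y$. The sum-product message leaving node $a$ along edge $j$ is $\int f_a(y_a=\hat y_a,s_a)\prod_{i\ne j}\mu_{s_i}(s_i)\,\mathrm ds_{a\setminus j}$, where $\mu_{s_i}$, $i\ne j$, are the messages arriving at $a$ along its other edges and $s_{a\setminus j}$ is all of $s_a$ except $s_j$; messages are not normalized. Each edge is arbitrarily directed; $\vec\mu$ and $\overleftarrow{\mu}$ are the messages along and against the direction. Integrals are over supports (sums for discrete variables).
   Formalization: Each model's graph and the prior's graph are assumed to be trees connected through latent edges; otherwise parts cut off from the edge of s_j, such as a factor p(y_1) of observed variables only, enter F_k but not the messages, and (i) fails. *)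

(* Defs.v *)
(* Messages, evidences and free energies are extended real valued, so that no
   integral has to be assumed finite unless tractability says so. *)
From HB Require Import structures.
From mathcomp Require Import all_boot all_order all_algebra.
From mathcomp Require Import all_classical all_reals all_analysis.

Set Implicit Arguments.
Unset Strict Implicit.
Unset Printing Implicit Defensive.

Import Order.TTheory GRing.Theory Num.Theory.
Import numFieldNormedType.Exports.

Local Open Scope classical_set_scope.
Local Open Scope ring_scope.

(** ** One-of-K vectors *)

Record onehot (K : nat) := OneHot {
  onehot_fun :> {ffun 'I_K -> bool};
  onehotP : (\sum_(k < K) onehot_fun k == 1)%N }.

HB.instance Definition _ K := [isSub for @onehot_fun K].
HB.instance Definition _ K := [Finite of onehot K by <:].

Lemma hot_subproof K (k : 'I_K) :
  (\sum_(i < K) [ffun i => i == k] i == 1)%N.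
Proof.
rewrite (bigD1 k)//= ffunE eqxx big1 ?addn0// => i ik.
by rewrite ffunE (negbTE ik).
Qed.

Definition hot K (k : 'I_K) : onehot K := OneHot (hot_subproof k).

HB.instance Definition _ n := isPointed.Build (onehot n.+1) (hot ord0).

HB.instance Definition _ n := @isMeasurable.Build default_measure_display
  (onehot n.+1) discrete_measurable discrete_measurable0
  discrete_measurableC discrete_measurableU.

Lemma onehot_sigma_finite (R : realType) n :
  sigma_finite [set: onehot n.+1] (@counting (onehot n.+1) R).
Proof.
exists (fun=> setT); first by rewrite bigcup_const.
by move=> k; split => //; rewrite /counting/= asboolT ?ltry.
Qed.

HB.instance Definition _ (R : realType) n := @Measure_isSigmaFinite.Build _ _ _
  (@counting (onehot n.+1) R) (onehot_sigma_finite R n).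

(** ** Variables and integration *)

(* A variable ranges over the measurable space [dom v]; [refm v] is the measure
   written "d v" (Lebesgue for a continuous variable, counting for a discrete
   one). *)
Record variables (R : realType) := Variables {
  var :> finType;
  vdisp : var -> measure_display;
  dom : forall v, measurableType (vdisp v);
  refm : forall v, {sigma_finite_measure set (dom v) -> \bar R} }.

Section integration.
Context (R : realType) (X : variables R).
Local Open Scope ereal_scope.

Definition asg : Type := forall v : X, dom v.

Definition cylinders : set (set (forall v : X, dom v)) :=
  [set A | exists v (B : set (dom v)),
     measurable B /\ A = (fun x : forall v : X, dom v => x v) @^-1` B].

(* [asg] with the product sigma-algebra *)
Definition masg := g_sigma_algebraType cylinders.

Fixpoint integrate (l : seq X) (F : asg -> \bar R) (x : asg) : \bar R :=
  if l is v :: l' then \int[refm v]_t integrate l' F (dfwith x v t) else F x.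

(* The integral of [F] over the coordinates in [S], the other coordinates being
   those of [x]. By Tonelli's theorem, for measurable [F >= 0] the order of
   integration is irrelevant and this is the integral for the product of the
   measures [refm]. *)
Definition integral_over (S : {set X}) (F : asg -> \bar R) (x : asg) : \bar R :=
  integrate (enum S) F x.

(* the Lebesgue integral, for the same product measure, of a function [F] of
   arbitrary sign *)
Definition sintegral_over (S : {set X}) (F : asg -> \bar R) (x : asg) :
    \bar R :=
  integral_over S F^\+ x - integral_over S F^\- x.

End integration.

(** ** Factor graphs *)

(* A stock of factors from which several models pick theirs. [args a] is the set
   of arguments of [fac a]. Only the coordinates of [data] in [observed] are
   meaningful: they are the observations; all other coordinates get integrated
   or overwritten. *)
Record factors (R : realType) (X : variables R) := Factors {
  node : finType;
  args : node -> {set X};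
  fac : node -> asg X -> R;
  fac_ge0 : forall a x, 0 <= fac a x;
  fac_measurable : forall a, measurable_fun [set: masg X] (fac a : masg X -> R);
  fac_args : forall a (x y : asg X),
    (forall v, v \in args a -> x v = y v) -> fac a x = fac a y;
  observed : {set X};
  data : asg X }.

Section factor_graphs.
Context (R : realType) (X : variables R) (Phi : factors X).
Local Open Scope ereal_scope.
Implicit Types (N : {set node Phi}) (a b : node Phi) (i j : X).

Definition edges a : {set X} := args a :\: observed Phi.

(* A model is given by the set [N] of its factors. *)
Definition model_vars N : {set X} := \bigcup_(a in N) args a.

Definition latent N : {set X} := model_vars N :\: observed Phi.

Definition joint N (x : asg X) : R := (\prod_(a in N) fac a x)%R.

Definition normalized N : Prop :=
  integral_over (model_vars N) (EFin \o joint N) (data Phi) = 1.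

(* The node-edge incidence graph. Its cycles are the cycles of the factor graph,
   including those made of two edges between the same two nodes. *)
Definition incidence N : rel (node Phi + X)%type := fun u v =>
  match u, v with
  | inl a, inr i | inr i, inl a => (a \in N) && (i \in edges a)
  | _, _ => false
  end.

Definition acyclic N : Prop :=
  forall c, ucycle (incidence N) c -> (size c <= 2)%N.

Definition connected_graph N : Prop :=
  {in N &, forall a b, connect (incidence N) (inl a) (inl b)}.

(* Forney-style: an edge joins two nodes or is a half-edge. *)
Definition forney N : Prop :=
  {in latent N, forall i, (#|[set a in N | i \in args a]| <= 2)%N}.

Definition forney_tree N : Prop :=
  [/\ forney N, connected_graph N & acyclic N].

(* p(y = yhat) *)
Definition evidence N : \bar R :=
  integral_over (latent N) (EFin \o joint N) (data Phi).

Definition tractable N : Prop := 0 < evidence N < +oo.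

(* the nodes on the side of [a] when the edge [j] is cut *)
Definition side N j a : {set node Phi} :=
  [set c in N | connect [rel u v | [&& incidence N u v, u != inr j & v != inr j]]
                        (inl a) (inl c)].

(** *** Sum-product messages *)

(* [mu a j] is the message leaving the node [a] along the edge [j]. *)
Definition messages : Type := node Phi -> forall i : X, dom i -> \bar R.

(* The message arriving at [a] along [i]; it leaves the other end of [i]. On a
   half-edge the product is empty and the message is 1. *)
Definition incoming N (mu : messages) a i (t : dom i) : \bar R :=
  \prod_(b in N | (b != a) && (i \in args b)) mu b i t.

Definition sum_product N (mu : messages) : Prop :=
  forall a j (t : dom j), a \in N -> j \in edges a ->
    mu a j t =
    integral_over (edges a :\ j)
      (fun x => (fac a x)%:E * \prod_(i in edges a :\ j) incoming N mu a (x i))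
      (dfwith (data Phi) j t).

(** *** Variational free energy *)

(* q ln (q / p), with the usual conventions 0 ln (0 / p) = 0 for every p and
   q ln (q / 0) = +oo for q > 0 *)
Definition qlnqp (q p : \bar R) : \bar R := q * lne (q / p).

Definition free_energy N (q : asg X -> R) : \bar R :=
  sintegral_over (latent N)
    (fun x => qlnqp (q x)%:E (joint N x)%:E) (data Phi).

Definition posterior N (x : asg X) : R := (joint N x / fine (evidence N))%R.

Definition posterior_marginal N j (t : dom j) : \bar R :=
  integral_over (latent N :\ j) (EFin \o posterior N) (dfwith (data Phi) j t).

End factor_graphs.

(** ** Mixtures of K models *)

Section mixture.
Context (R : realType) (X : variables R) (Phi : factors X) (K : nat).
Variable N : 'I_K -> {set node Phi}.
Local Open Scope ereal_scope.
Implicit Types (m : onehot K) (k : 'I_K) (j : X).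

Definition overlapping_factors : {set node Phi} := \bigcap_(k < K) N k.

Definition overlapping_latent : {set X} := \bigcap_(k < K) latent (N k).

(* s_k for the k with m_k = 1: given m, the latent variables of the other models
   are absent from q(s,m) and from p(y,s,m). *)
Definition selected_latent m : {set X} := \bigcup_(k < K | m k) latent (N k).

(* p(y = yhat, s, m) *)
Definition mixture_joint (p : onehot K -> R) m (x : asg X) : R :=
  (p m * \prod_(k < K) joint (N k) x ^+ m k)%R.

(* q(s, m) under exact inference in each model *)
Definition mixture_q (q : onehot K -> R) m (x : asg X) : R :=
  (q m * \prod_(k < K) posterior (N k) x ^+ m k)%R.

Definition mixture_free_energy (p q : onehot K -> R) : \bar R :=
  \sum_(m : onehot K)
    sintegral_over (selected_latent m)
      (fun x => qlnqp (mixture_q q m x)%:E (mixture_joint p m x)%:E)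
      (data Phi).

Definition f_m m : \bar R :=
  \prod_(k < K) expeR (- free_energy (N k) (posterior (N k))) ^+ m k.

Definition distribution_m (q : onehot K -> R) : Prop :=
  (forall m, 0 <= q m)%R /\ (\sum_(m : onehot K) q m = 1)%R.

Definition optimal_q (p q : onehot K -> R) : Prop :=
  distribution_m q /\
  forall q', distribution_m q' ->
    mixture_free_energy p q <= mixture_free_energy p q'.

(* q(s_j), marginalized over the models *)
Definition mixture_marginal (q : onehot K -> R) j (t : dom j) : \bar R :=
  \sum_(m : onehot K)
    (q m)%:E * \prod_(k < K) posterior_marginal (N k) t ^+ m k.

End mixture.

(** ** The mixture node *)

(* Its incoming messages are [mum] on the edge of m, [fwd k] on the edge of
   s_j | m_k = 1 and [bwd] on the edge of s_j. *)
Section mixture_node.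
Context (R : realType) (X : variables R) (K : nat) (j : X).
Local Open Scope ereal_scope.
Implicit Types (mum : onehot K -> \bar R) (fwd : 'I_K -> dom j -> \bar R).
Implicit Types (bwd : dom j -> \bar R).

Definition mixture_to_m fwd bwd (m : onehot K) : \bar R :=
  \prod_(k < K) (\int[refm j]_t (fwd k t * bwd t)) ^+ m k.

Definition mixture_to_s mum fwd (t : dom j) : \bar R :=
  \sum_(k < K) mum (hot k) * fwd k t.

Definition mixture_to_model bwd (k : 'I_K) (t : dom j) : \bar R := bwd t.

End mixture_node.

(** ** The graph of the prior on m *)

(* The variables of the graph of p(m): the additional variables [W] and m, which
   is [None]. *)
Section prior.
Context (R : realType) (n : nat) (W : variables R).
Local Open Scope ereal_scope.

Definition prior_vdisp (v : option W) : measure_display :=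
  if v is Some w then vdisp w else default_measure_display.

Definition prior_dom (v : option W) : measurableType (prior_vdisp v) :=
  match v return measurableType (prior_vdisp v) with
  | Some w => dom w
  | None => onehot n.+1
  end.

Definition prior_refm (v : option W) :
    {sigma_finite_measure set (prior_dom v) -> \bar R} :=
  match v return {sigma_finite_measure set (prior_dom v) -> \bar R} with
  | Some w => refm w
  | None => @counting (onehot n.+1) R
  end.

Definition prior_variables : variables R := Variables prior_refm.

Definition mvar : prior_variables := None.

Context (Psi : factors prior_variables).

(* the function of m defined by the graph, all additional latent variables being
   integrated out *)
Definition prior_mass (m : onehot n.+1) : \bar R :=
  integral_over (latent [set: node Psi] :\ mvar)
    (EFin \o joint [set: node Psi]) (dfwith (data Psi) mvar m).

(* p(m). The normalization is only effective when the graph contains observed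
   variables (e.g. earlier time slices) or unnormalized factors. *)
Definition prior_pmf (m : onehot n.+1) : R :=
  fine (prior_mass m) / \sum_(m' : onehot n.+1) fine (prior_mass m').

(* m is a latent half-edge of an acyclic graph, attached to the node [am]; the
   message leaving [am] along m is the one sent by the prior. *)
Definition prior_graph (am : node Psi) : Prop :=
  [/\ forney_tree [set: node Psi],
      mvar \notin observed Psi,
      (forall a, (mvar \in args a) = (a == am)) &
      0 < \sum_(m : onehot n.+1) prior_mass m < +oo].

End prior.

(* Main.v *)
Require Import Defs.
From HB Require Import structures.
From mathcomp Require Import all_boot all_order all_algebra.
From mathcomp Require Import all_classical all_reals all_analysis.
From mathcomp Require Import measurable_realfun ring lra.

(** On a tree, the message [mu a j] is the integral of the product of all factors
    on the side of [a] when the edge [j] is cut, over all latent variables of that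
    side: by Tonelli this integral splits over the subtrees hanging from [a], which
    is the sum-product recursion. Hence the product of the two messages on [j] is
    the integral of the joint density over all other latent variables; integrating
    [j] as well gives the evidence, which is [exp (- F)] at the exact posterior,
    where the log-ratio [ln (q / p)] is constant.

    In the mixture free energy the same cancellation leaves
    [sum_m q(m) ln (q(m) / (p(m) f_m(m)))], whose unique minimizer is the
    normalization of [p f_m] by the equality case of Gibbs' inequality. The message
    from the graph of [p(m)] is [p(m)] up to a factor, again by the tree formula. *)

Set Implicit Arguments.
Unset Strict Implicit.
Unset Printing Implicit Defensive.

Import Order.TTheory GRing.Theory Num.Theory.
Import numFieldNormedType.Exports.

(** * Branches of an acyclic graph *)

Section branches.
Context (T : finType) (e : rel T).
Hypothesis e_sym : symmetric e.
Hypothesis e_irr : irreflexive e.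
Hypothesis e_acyclic : forall c, ucycle e c -> (size c <= 2)%N.
Implicit Types u v w x : T.

(** For the incidence graph and [v = inr j] this is the relation inside [side]. The set [branch u v]
    thus keeps the variables on the cut side together with its nodes. *)
Definition avoid v : rel T := [rel x y | [&& e x y, x != v & y != v]].

Definition branch u v : {set T} := [set x | connect (avoid v) u x].

Lemma avoid_csym v : connect_sym (avoid v).
Proof. by apply: sym_connect_sym => x y; rewrite /avoid/= e_sym (andbC (x != v)). Qed.

Lemma mem_branch u v : u \in branch u v.
Proof. by rewrite inE connect0. Qed.

Lemma avoid_path v x p : path (avoid v) x p -> path e x p /\ v \notin p.
Proof.
elim: p x => //= y p IH x /andP[/and3P[-> _ yv] /IH[-> vp]].
by rewrite inE negb_or eq_sym yv.
Qed.

Lemma path_avoid v x p : path e x p -> v \notin x :: p -> path (avoid v) x p.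
Proof.
elim: p x => //= y p IH x /andP[xy yp]; rewrite !inE !negb_or.
case/and3P=> vx vy vp; rewrite {1}/avoid/= xy (eq_sym x) vx (eq_sym y) vy/=.
by apply: IH => //; rewrite inE negb_or vy.
Qed.

Lemma branch_notin u v : u != v -> v \notin branch u v.
Proof.
move=> uv; apply/negP; rewrite inE => /connectP[p /avoid_path[_ vp] E].
by move: (mem_last u p); rewrite -E inE (negbTE vp) orbF eq_sym (negbTE uv).
Qed.

(* Two neighbours of [v] joined by a path avoiding [v] would close a cycle. *)
Lemma branch_disjoint v w w' : e v w -> e v w' -> w != w' -> w != v -> w' != v ->
  [disjoint branch w v & branch w' v].
Proof.
move=> vw vw' ww' wv w'v; apply/pred0P => x /=; apply/negP => /andP[].
rewrite !inE => wx; rewrite avoid_csym => xw'.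
have /connectP[p0 p0P] := connect_trans wx xw'.
have [p pP pU _ E] := shortenP p0P.
have [ep vp] := avoid_path pP.
have /e_acyclic : ucycle e (v :: w :: p).
  apply/andP; split.
    by rewrite /= vw rcons_path ep -E e_sym.
  by rewrite /= inE negb_or eq_sym wv vp.
by case: p E {pP pU ep vp} => //= E; rewrite E eqxx in ww'.
Qed.

(** The branches of [w] and [v] at [u] are disjoint, so a path from [w] that avoids [u] can never
    meet [v]; prefixing the step from [u] to [w] gives a path in the larger branch. *)
Lemma branch_sub u v w : e u v -> e w u -> w != v -> u != v -> w != u ->
  branch w u \subset branch u v.
Proof.
move=> uv wu wv uNv wNu; apply/fintype.subsetP => x xw.
have vw : v \notin branch w u.
  have : [disjoint branch w u & branch v u].
    by apply: branch_disjoint; rewrite // 1?e_sym// eq_sym.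
  by move/pred0P/(_ v); rewrite /= mem_branch andbT => ->.
move: xw; rewrite !inE => /connectP[p pP ->].
have [ep up] := avoid_path pP.
apply: (@connect_trans _ _ w).
  by apply: connect1; rewrite /avoid/= e_sym wu uNv wv.
apply/connectP; exists p => //; apply: path_avoid => //.
rewrite inE negb_or eq_sym wv/=; apply/negP => vp.
move/negP: vw; apply; rewrite inE.
case/splitPr: p / vp pP {ep up} => p1 p2; rewrite cat_path => /andP[p1P /= /andP[l _]].
by apply/connectP; exists (rcons p1 v); rewrite ?last_rcons// rcons_path p1P.
Qed.

(** A path without repetition never returns to [u] after its first step. *)
Lemma branch_cases u v x : x \in branch u v -> x != u ->
  exists2 w, e w u && (w != v) && (w != u) & x \in branch w u.
Proof.
rewrite inE => /connectP[p0 p0P ->]; have [p pP pU _ {p0 p0P}] := shortenP p0P.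
case: p pP pU => [|w p] /=; first by rewrite eqxx.
case/andP=> /and3P[uw uv wv] pP /and3P[]; rewrite inE negb_or => /andP[uNw up] wp pU _.
exists w; first by rewrite e_sym uw wv eq_sym uNw.
have [ep _] := avoid_path pP.
by rewrite inE; apply/connectP; exists p => //; apply: path_avoid => //; rewrite inE negb_or uNw.
Qed.

Lemma connect_branch v x : connect e v x -> x != v ->
  exists2 w, e w v && (w != v) & x \in branch w v.
Proof.
case/connectP=> p0 p0P ->; have [p pP pU _ {p0 p0P}] := shortenP p0P.
case: p pP pU => [|w p] /=; first by rewrite eqxx.
case/andP=> vw pP /and3P[]; rewrite inE negb_or => /andP[vNw vp] wp pU _.
exists w; first by rewrite e_sym vw eq_sym.
by rewrite inE; apply/connectP; exists p => //; apply: path_avoid => //; rewrite inE negb_or vNw.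
Qed.

Lemma branch_step u v x y : x \in branch u v -> x != v -> e x y -> y != v ->
  y \in branch u v.
Proof.
rewrite !inE => ux xv xy yv; apply: connect_trans ux _.
by apply: connect1; rewrite /avoid/= xy xv.
Qed.

Lemma edge_neq u v : e u v -> u != v.
Proof. by apply: contraTneq => ->; rewrite e_irr. Qed.

Lemma branch_edge u v x : x \in branch u v -> x != u -> exists y, e x y.
Proof.
rewrite inE avoid_csym => /connectP[[|y p]] /=; first by move=> _ ->; rewrite eqxx.
by case/andP=> /and3P[xy _ _] _ _ _; exists y.
Qed.

(* [p.1] is a child of [u], and [p.2] a child of [p.1], in the tree rooted at [v]. *)
Definition grandchild u v (p : T * T) :=
  [&& e p.1 u, p.1 != v, e p.2 p.1 & p.2 != u].

Lemma grandchild_sub u v p : grandchild u v p -> branch p.2 p.1 \subset branch p.1 u.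
Proof.
case/and4P=> iu iv wi wu.
by apply: branch_sub; rewrite // edge_neq.
Qed.

Lemma grandchild_notin u v p : grandchild u v p -> u \notin branch p.2 p.1.
Proof.
move=> up; apply: contra (fintype.subsetP (grandchild_sub up) u) _.
by case/and4P: up => iu _ _ _; rewrite branch_notin// edge_neq.
Qed.

(** A child lies in its own branch at [u], which is disjoint from those of its siblings. Hence the
    edges of a node are not among the variables of the subtrees hanging from it. *)
Lemma child_grandchild_notin u v p x : grandchild u v p -> e x u ->
  x \notin branch p.2 p.1.
Proof.
move=> up xu; have [iu _ wi _] := and4P up.
have [->|xi] := eqVneq x p.1; first by rewrite branch_notin// edge_neq.
apply/negP => /(fintype.subsetP (grandchild_sub up)) x1.
have : [disjoint branch x u & branch p.1 u].
  by apply: branch_disjoint; rewrite // 1?e_sym// edge_neq.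
by move/pred0P/(_ x); rewrite /= mem_branch x1.
Qed.

(** Grandchildren with a common parent are separated at that parent; the others lie in the disjoint
    branches of two children of [u]. *)
Lemma grandchild_disjoint u v p q : grandchild u v p -> grandchild u v q -> p != q ->
  [disjoint branch p.2 p.1 & branch q.2 q.1].
Proof.
move=> up uq pq; have [iu _ wi wu] := and4P up; have [iu' _ wi' wu'] := and4P uq.
have [E|ii] := eqVneq p.1 q.1.
  have E2 : p.2 != q.2.
    by apply: contraNneq pq => E2; rewrite [p]surjective_pairing E E2 -surjective_pairing.
  by rewrite -E in wi' *; apply: branch_disjoint; rewrite // 1?e_sym// edge_neq.
have : [disjoint branch p.1 u & branch q.1 u].
  by apply: branch_disjoint; rewrite // 1?e_sym// edge_neq.
by apply: disjointW; [exact: (grandchild_sub up)|exact: (grandchild_sub uq)].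
Qed.

(** The incidence graph is bipartite, so one unfolding of the sum-product recursion descends two
    levels: from a node to its other edges, then to the nodes at their far ends. *)
Lemma branchP u v x : e u v ->
  reflect [\/ x = u, e x u && (x != v) | exists2 p, grandchild u v p & x \in branch p.2 p.1]
          (x \in branch u v).
Proof.
move=> uv; apply: (iffP idP) => [xuv|].
  have [->|xu] := eqVneq x u; first by constructor 1.
  have [i /andP[/andP[iu iv] _] xi] := branch_cases xuv xu.
  have [->|xNi] := eqVneq x i; first by constructor 2; rewrite iu iv.
  have [w /andP[/andP[wi wu] _] xw] := branch_cases xi xNi.
  by constructor 3; exists (i, w) => //=; apply/and4P.
case=> [->|/andP[xu xv]|[p up xp]]; first exact: mem_branch.
  by apply: (branch_step (mem_branch u v)); rewrite // 1?e_sym// edge_neq.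
have [iu iv wi wu] := and4P up.
apply: (fintype.subsetP _ _ (fintype.subsetP (grandchild_sub up) _ xp)).
by apply: branch_sub; rewrite // edge_neq.
Qed.

End branches.

Local Open Scope ring_scope.
Local Open Scope ereal_scope.

(** * Integration over sets of coordinates *)

Lemma bigcup_seqP (T : finType) (I : eqType) (s : seq I) (V : I -> {set T}) v :
  reflect (exists2 i, i \in s & v \in V i) (v \in \bigcup_(i <- s) V i).
Proof.
elim: s => [|i s IH]; first by rewrite big_nil inE; constructor => -[].
rewrite big_cons inE; apply: (iffP orP) => [[vi|/IH[j js vj]]|[j]].
- by exists i; rewrite ?mem_head.
- by exists j; rewrite // inE js orbT.
- by rewrite inE => /orP[/eqP->|js] vj; [left|right; apply/IH; exists j].
Qed.

Lemma bigcup_disjoint_seq (T : finType) (I : eqType) (s : seq I) (V : I -> {set T}) (A : {set T}) :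
  {in s, forall i, [disjoint A & V i]} -> [disjoint A & \bigcup_(i <- s) V i].
Proof.
move=> AV; apply/pred0P => v /=; apply/negP => /andP[vA /bigcup_seqP[i /AV]].
by move/pred0P/(_ v); rewrite /= vA => /= ->.
Qed.

Section iterated_integrals.
Context (R : realType) (X : variables R).
Implicit Types (x y : asg X) (u v w : X) (l : seq X) (F G : asg X -> \bar R).

Definition nonneg_measurable F :=
  measurable_fun [set: masg X] (F : masg X -> \bar R) /\ forall x, 0 <= F x.

Lemma dfwith_comm x v w (s : dom v) (t : dom w) : v != w ->
  dfwith (dfwith x v s) w t = dfwith (dfwith x w t) v s.
Proof.
move=> vw; apply: functional_extensionality_dep => u.
have [<-|wu] := eqVneq w u; first by rewrite dfwithin dfwithout// dfwithin.
rewrite dfwithout//; have [<-|vu] := eqVneq v u; first by rewrite !dfwithin.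
by rewrite !dfwithout.
Qed.

Lemma measurable_coord v :
  measurable_fun [set: masg X] ((fun x => x v) : masg X -> dom v).
Proof.
move=> _ B mB; rewrite setTI; apply: sub_sigma_algebra.
by exists v, B.
Qed.

Lemma measurable_masg d (T : measurableType d) (f : T -> masg X) :
  (forall v, measurable_fun [set: T] (fun t => (f t : asg X) v)) ->
  measurable_fun [set: T] f.
Proof.
move=> mf; apply: (@measurability _ _ T (masg X) setT f (@cylinders R X)) => //.
move=> _ [_ [v [B [mB ->]]] <-].
exact: mf.
Qed.

Lemma measurable_dfwith v :
  measurable_fun [set: (masg X * dom v)%type]
    ((fun p => dfwith (p.1 : asg X) v p.2) : masg X * dom v -> masg X).
Proof.
apply: measurable_masg => w; have [<-|vw] := eqVneq v w.
  rewrite [X in measurable_fun _ X](_ : _ = snd) //.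
  by apply/funext => p; rewrite dfwithin.
rewrite [X in measurable_fun _ X](_ : _ = (fun x : masg X => (x : asg X) w) \o fst).
  by apply: measurableT_comp => //; exact: measurable_coord.
by apply/funext => p; rewrite dfwithout.
Qed.

Lemma measurable_dfwith2 x v : measurable_fun [set: dom v]
  ((fun t => dfwith x v t) : dom v -> masg X).
Proof.
have := @measurable_fun_pair2 _ _ _ _ _ _ _ (x : masg X) (@measurable_dfwith v).
exact.
Qed.

Lemma nonneg_measurable_section F x v : nonneg_measurable F ->
  measurable_fun [set: dom v] (fun t => F (dfwith x v t)).
Proof.
move=> [mF _]. exact: (measurableT_comp mF (@measurable_dfwith2 x v)).
Qed.

Lemma nonneg_measurable_integral F v : nonneg_measurable F ->
  nonneg_measurable (fun x => \int[refm v]_t F (dfwith x v t)).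
Proof.
move=> [mF F0]; split=> [|x]; last exact: integral_ge0.
apply: (@measurable_fun_fubini_tonelli_F _ _ (masg X) (dom v) R (refm v)
  (fun p => F (dfwith (p.1 : asg X) v p.2))) => //.
exact: (measurableT_comp mF (@measurable_dfwith v)).
Qed.

Lemma nonneg_measurable_integrate F l : nonneg_measurable F ->
  nonneg_measurable (integrate l F).
Proof. by elim: l => //= v l IH F0; apply: nonneg_measurable_integral; apply: IH. Qed.

Lemma integrate_cat l1 l2 F : integrate (l1 ++ l2) F = integrate l1 (integrate l2 F).
Proof. by elim: l1 => //= v l1 ->. Qed.

(** Restricting to assignments that agree with [x] outside [l] keeps the observations and the
    argument of a message fixed under the integral. *)
Lemma eq_integrate l F G x :
  (forall y, (forall v, v \notin l -> y v = x v) -> F y = G y) ->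
  integrate l F x = integrate l G x.
Proof.
elim: l x => /= [|v l IH] x FG; first exact: FG.
apply: eq_integral => t _; apply: IH => y yP; apply: FG => w.
by rewrite inE negb_or => /andP[wv wl]; rewrite yP// dfwithout// eq_sym.
Qed.

Lemma integrate_swap F v w x : nonneg_measurable F ->
  integrate [:: v; w] F x = integrate [:: w; v] F x.
Proof.
have [->//|vw] := eqVneq v w; move=> [mF F0] /=.
transitivity (\int[refm w]_s \int[refm v]_t F (dfwith (dfwith x v t) w s)).
  apply: (@fubini_tonelli _ _ _ _ R (refm v) (refm w)
     (fun p => F (dfwith (dfwith x v p.1) w p.2))) => //.
  have mh : measurable_fun [set: (dom v * dom w)%type]
      ((fun p => (dfwith x v p.1, p.2)) : _ -> (masg X * dom w)%type).
    apply: measurable_fun_pair => //.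
    exact: (measurableT_comp (@measurable_dfwith2 x v)).
  exact: (measurableT_comp mF (measurableT_comp (@measurable_dfwith w) mh)).
by apply: eq_integral => s _; apply: eq_integral => t _; rewrite dfwith_comm.
Qed.

Lemma integrate_front l1 v l2 F x : nonneg_measurable F ->
  integrate (l1 ++ v :: l2) F x = integrate (v :: l1 ++ l2) F x.
Proof.
move=> F0; elim: l1 x => //= w l1 IH x.
under eq_integral do rewrite IH/=.
exact/(integrate_swap w v x)/nonneg_measurable_integrate.
Qed.

Lemma perm_integrate l1 l2 F x : perm_eq l1 l2 -> nonneg_measurable F ->
  integrate l1 F x = integrate l2 F x.
Proof.
move=> + F0; elim: l1 l2 x => [|v l1 IH] l2 x; first by rewrite perm_sym => /perm_nilP->.
move=> p; have vl2 : v \in l2 by rewrite -(perm_mem p) mem_head.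
case/splitPr: vl2 p => l3 l4; rewrite perm_sym perm_catC/= perm_cons perm_catC perm_sym => p.
rewrite integrate_front//=; apply: eq_integral => t _; exact: IH.
Qed.

Lemma perm_enum_setU (A B : {set X}) : [disjoint A & B] ->
  perm_eq (enum (A :|: B)) (enum A ++ enum B).
Proof.
move=> AB; apply: uniq_perm; rewrite ?enum_uniq//.
  rewrite cat_uniq !enum_uniq/= andbT; apply/hasPn => v; rewrite !mem_enum => vB.
  by apply/negP => vA; move/pred0P: AB => /(_ v)/=; rewrite vA vB.
by move=> v; rewrite mem_cat !mem_enum inE.
Qed.

Lemma integral_overU (A B : {set X}) F x : [disjoint A & B] -> nonneg_measurable F ->
  integral_over (A :|: B) F x = integral_over A (integral_over B F) x.
Proof.
move=> AB F0; rewrite /integral_over -integrate_cat.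
by apply: perm_integrate => //; exact: perm_enum_setU.
Qed.

Lemma integral_over1 v F x :
  integral_over [set v] F x = \int[refm v]_t F (dfwith x v t).
Proof. by rewrite /integral_over enum_set1. Qed.

Lemma integral_over0 F x : integral_over finset.set0 F x = F x.
Proof. by rewrite /integral_over enum_set0. Qed.

Lemma nonneg_measurable_integral_over F (S : {set X}) : nonneg_measurable F ->
  nonneg_measurable (integral_over S F).
Proof. exact: nonneg_measurable_integrate. Qed.

Lemma eq_integral_over (S : {set X}) F G x :
  (forall y, (forall v, v \notin S -> y v = x v) -> F y = G y) ->
  integral_over S F x = integral_over S G x.
Proof.
move=> FG; apply: eq_integrate => y yP; apply: FG => v vS; apply: yP.
by rewrite mem_enum.
Qed.

Definition depends_on (S : {set X}) F :=
  forall x y, (forall v, v \in S -> x v = y v) -> F x = F y.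

Lemma depends_on_integral_over (S T : {set X}) F : depends_on S F ->
  depends_on (S :\: T) (integral_over T F).
Proof.
rewrite /integral_over => dF.
suff {S dF}H l : forall S, depends_on S F -> depends_on (S :\: [set v in l]) (integrate l F).
  by have := H (enum T) S dF; rewrite set_enum.
elim: l => [|v l IH] S dF x y xy; first by apply: dF => v vS; apply: xy; rewrite !inE.
apply: eq_integral => t _; apply: (IH S) => // w; rewrite !inE => /andP[wl wS].
have [<-|vw] := eqVneq v w; first by rewrite !dfwithin.
by rewrite !dfwithout//; apply: xy; rewrite !inE negb_or eq_sym vw wl.
Qed.

(** The integral only sees assignments that agree with [x] off [S]. There [G] is constant, so it
    leaves the iterated integrals one at a time. *)
Lemma integral_overZl (S : {set X}) F G x :
  nonneg_measurable F -> (forall y, 0 <= G y) ->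
  (forall y, (forall v, v \notin S -> y v = x v) -> G y = G x) ->
  integral_over S (fun y => G y * F y) x = G x * integral_over S F x.
Proof.
move=> F0 G0 GS.
have {}GS y : (forall v, v \notin enum S -> y v = x v) -> G y = G x.
  by move=> yP; apply: GS => v vS; apply: yP; rewrite mem_enum.
rewrite /integral_over; elim: (enum S) x GS => //= v l IH x Gx.
rewrite -ge0_integralZl//; last 2 first.
- exact/nonneg_measurable_section/nonneg_measurable_integrate.
- by move=> t _; exact: (nonneg_measurable_integrate _ F0).2.
apply: eq_integral => t _.
have Gxt : G (dfwith x v t) = G x.
  by apply: Gx => w; rewrite inE negb_or => /andP[wv _]; rewrite dfwithout// eq_sym.
rewrite IH ?Gxt// => y yP; apply: Gx => w.
by rewrite inE negb_or => /andP[wv wl]; rewrite yP// dfwithout// eq_sym.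
Qed.

Lemma nonneg_measurableM F G : nonneg_measurable F -> nonneg_measurable G ->
  nonneg_measurable (fun x => F x * G x).
Proof.
move=> [mF F0] [mG G0]; split=> [|x]; last exact: mule_ge0.
exact: emeasurable_funM.
Qed.

Lemma nonneg_measurable_prod (I : Type) (s : seq I) (P : pred I) (F : I -> asg X -> \bar R) :
  (forall i, P i -> nonneg_measurable (F i)) ->
  nonneg_measurable (fun x => \prod_(i <- s | P i) F i x).
Proof.
move=> F0; elim: s => [|i s IH].
  rewrite (_ : (fun _ => _) = cst 1); last by apply/funext => x; rewrite big_nil.
  by split=> [|x]; [exact: measurable_cst|rewrite lee01].
rewrite (_ : (fun _ => _) =
    (fun x => (if P i then F i x else 1) * \prod_(j <- s | P j) F j x)); last first.
  by apply/funext => x; rewrite big_cons; case: ifP; rewrite // mul1e.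
case: (boolP (P i)) => Pi; last by under eq_fun do rewrite mul1e.
exact/nonneg_measurableM/IH/F0.
Qed.

(** The set [D i] holds the coordinates that [F i] depends on. These sets may overlap away from the
    [V i], which allows a shared edge and shared observations in all factors. *)
Lemma integral_over_prod (I : eqType) (s : seq I) (V : I -> {set X})
    (F : I -> asg X -> \bar R) (D : I -> {set X}) x :
  uniq s -> {in s, forall i, nonneg_measurable (F i)} ->
  {in s, forall i, depends_on (D i) (F i)} ->
  {in s &, forall i j, i != j -> [disjoint V i & V j] /\ [disjoint V i & D j]} ->
  integral_over (\bigcup_(i <- s) V i) (fun y => \prod_(i <- s) F i y) x =
  \prod_(i <- s) integral_over (V i) (F i) x.
Proof.
elim: s x => [|i s IH] x; first by rewrite !big_nil integral_over0 big_nil.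
move=> /= /andP[is_ us] F0 dF VD; rewrite !big_cons.
rewrite (_ : (fun _ => _) = (fun y => F i y * \prod_(j <- s) F j y)); last first.
  by apply/funext => y; rewrite big_cons.
have F0i : nonneg_measurable (F i) by apply: F0; rewrite mem_head.
have F0s : nonneg_measurable (fun y => \prod_(j <- s) F j y).
  rewrite (_ : (fun _ => _) = (fun y => \prod_(j <- s | j \in s) F j y)); last first.
    by apply/funext => y; rewrite big_seq.
  by apply: nonneg_measurable_prod => j js; apply: F0; rewrite inE js orbT.
have memS j : j \in s -> j \in i :: s by rewrite inE orbC => ->.
have ne j : j \in s -> i != j by apply: contraTneq => <-.
have Vi j : j \in s -> [disjoint V i & V j] /\ [disjoint V i & D j].
  by move=> js; apply: VD; rewrite ?mem_head ?memS ?ne.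
have iV j : j \in s -> [disjoint V j & D i].
  by move=> js; apply: (VD _ _ _ _ _).2; rewrite ?mem_head ?memS 1?eq_sym ?ne.
rewrite integral_overU; last 2 first.
- by rewrite bigcup_disjoint_seq// => j /Vi[].
- exact: nonneg_measurableM.
(* First [F i] leaves the inner integral, since [D i] misses every later [V j]; then [H] leaves the
   outer one, since [V i] misses every later [D j]. *)
pose H := integral_over (\bigcup_(j <- s) V j) (fun y => \prod_(j <- s) F j y).
have HE y : H y = \prod_(j <- s) integral_over (V j) (F j) y.
  apply: IH => // [j js|j js|j k js ks jk]; [exact/F0/memS|exact/dF/memS|].
  by apply: VD => //; exact: memS.
transitivity (integral_over (V i) (fun y => H y * F i y) x).
  apply: eq_integral_over => y _; rewrite muleC integral_overZl//; first exact: F0i.2.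
  move=> z zy; apply: (dF i); rewrite ?mem_head// => v vD; apply: zy.
  apply/negP => /bigcup_seqP[j js vj].
  by move/pred0P: (iV _ js) => /(_ v)/=; rewrite vj vD.
rewrite integral_overZl; last 3 first.
- exact: F0i.
- by move=> y; exact: (nonneg_measurable_integral_over _ F0s).2.
- move=> y yx; rewrite !HE !big_seq; apply: eq_bigr => j js.
  apply: (depends_on_integral_over (dF j (memS _ js))) => v /setDP[vD _].
  by apply: yx; apply/negP => vi; move/pred0P: (Vi _ js).2 => /(_ v)/=; rewrite vi vD.
by rewrite HE muleC.
Qed.
End iterated_integrals.

(** * Sum-product messages on trees *)

Section messages_on_trees.
Context (R : realType) (X : variables R) (Phi : factors X) (N : {set node Phi}).
Hypothesis N_acyclic : acyclic N.
Implicit Types (a b c : node Phi) (i j v : X) (x y : asg X).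

Lemma incidence_sym : symmetric (incidence N).
Proof. by move=> [a|i] [b|j]. Qed.

Lemma incidence_irr : irreflexive (incidence N).
Proof. by move=> [a|i]. Qed.

Definition branch_nodes (u v : (node Phi + X)%type) : {set node Phi} :=
  [set c | inl c \in branch (incidence N) u v].

Definition branch_vars (u v : (node Phi + X)%type) : {set X} :=
  [set i | inr i \in branch (incidence N) u v].

Lemma in_branch_nodes (u v : (node Phi + X)%type) c :
  (c \in branch_nodes u v) = (inl c \in branch (incidence N) u v).
Proof. by rewrite finset.in_set. Qed.

Lemma in_branch_vars (u v : (node Phi + X)%type) i :
  (i \in branch_vars u v) = (inr i \in branch (incidence N) u v).
Proof. by rewrite finset.in_set. Qed.

Definition weight (A : {set node Phi}) x : \bar R := \prod_(c in A) (fac c x)%:E.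

(** A node other than [a] that is reached by a path has an incident edge, and incidence already
    requires membership in [N]. *)
Lemma sideE a j : a \in N -> side N j a = branch_nodes (inl a) (inr j).
Proof.
move=> aN; apply/setP => c; rewrite !inE -/(avoid _ _).
apply: andb_idl => ac; have [->//|ca] := eqVneq c a.
have := @branch_edge _ _ incidence_sym (inl a) (inr j) (inl c).
rewrite inE => /(_ ac) []; first by apply: contraNneq ca => -[->].
by case=> // i /andP[].
Qed.

Lemma branch_nodes_sub a j : a \in N -> branch_nodes (inl a) (inr j) \subset N.
Proof. by move=> aN; rewrite -sideE//; apply/fintype.subsetP => c; rewrite inE => /andP[]. Qed.

Lemma branch_vars_edge a j v : v \in branch_vars (inl a) (inr j) ->
  exists2 c, c \in N & v \in edges c.
Proof.
rewrite inE => /(@branch_edge _ _ incidence_sym) [] // -[c|//] /andP[cN vc].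
by exists c.
Qed.

Lemma nonneg_measurable_fac c : nonneg_measurable (EFin \o fac c).
Proof.
split=> [|x]; last by rewrite lee_fin fac_ge0.
by apply/measurable_EFinP; exact: fac_measurable.
Qed.

Lemma nonneg_measurable_weight A : nonneg_measurable (weight A).
Proof. by apply: nonneg_measurable_prod => c _; exact: nonneg_measurable_fac. Qed.

Lemma joint_weight : EFin \o joint N = weight N.
Proof. by apply/funext => x; rewrite /= /weight prodEFin. Qed.

(** An argument of a factor of the branch is observed, or is [j], or is reached from that factor by
    one more step avoiding [j]. *)
Lemma depends_on_weight a j : a \in N ->
  depends_on (branch_vars (inl a) (inr j) :|: (j |: observed Phi))
    (weight (branch_nodes (inl a) (inr j))).
Proof.
move=> aN x y xy; apply: eq_bigr => c cB; congr _%:E; apply: fac_args => v vc.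
apply: xy; rewrite finset.in_setU in_setU1.
have [vobs|vobs] := boolP (v \in observed Phi); first by rewrite !orbT.
have [->|vj] := eqVneq v j; first by rewrite orbT.
have cN := fintype.subsetP (branch_nodes_sub j aN) _ cB.
rewrite in_branch_nodes in cB; rewrite in_branch_vars !orbF; apply: (branch_step cB) => //.
by rewrite /= cN finset.in_setD vobs.
Qed.

Definition branch_mass a j : asg X -> \bar R :=
  integral_over (branch_vars (inl a) (inr j)) (weight (branch_nodes (inl a) (inr j))).

Lemma depends_on_branch_mass a j : a \in N -> depends_on (j |: observed Phi) (branch_mass a j).
Proof.
move=> aN x y xy; apply: (depends_on_integral_over (depends_on_weight aN)) => v.
by rewrite finset.in_setD finset.in_setU => /andP[/negbTE->]; exact: xy.
Qed.

Lemma observed_branch a j v : v \in observed Phi -> v \notin branch_vars (inl a) (inr j).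
Proof. by apply: contraL => /branch_vars_edge[c _ /setDP[]]. Qed.

Lemma nonneg_measurable_branch_mass a j : nonneg_measurable (branch_mass a j).
Proof. exact/nonneg_measurable_integral_over/nonneg_measurable_weight. Qed.

(** The pairs index the product over edges [i] of the products [incoming N mu a] over the other
    nodes on [i], flattened into a single product. *)
Definition grandchildren a j : seq (X * node Phi) :=
  [seq p <- enum {: X * node Phi} | [&& p.1 \in edges a :\ j, p.2 \in N, p.2 != a & p.1 \in args p.2]].

Lemma edges_args i a c : i \in edges a -> i \in args c -> i \in edges c.
Proof. by move=> /setDP[_ io] ic; apply/setDP. Qed.

Lemma mem_grandchildren a j p : a \in N -> p \in grandchildren a j =
  grandchild (incidence N) (inl a) (inr j) (inr p.1, inl p.2).
Proof.
move=> aN; rewrite mem_filter mem_enum andbT /grandchild/= in_setD1 aN.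
have [pa|//] /= := boolP (p.1 \in edges a); last by rewrite !andbF.
rewrite andbT (inj_eq inl_inj) (inj_eq inr_inj); congr andb.
have -> : (p.1 \in edges p.2) = (p.1 \in args p.2).
  by apply/idP/idP; [case/setDP|exact: (edges_args pa)].
by case: (p.2 \in N); case: (p.1 \in args p.2); case: (p.2 != a).
Qed.

Lemma branch_varsE a j : a \in N -> j \in edges a -> branch_vars (inl a) (inr j) =
  (edges a :\ j) :|: \bigcup_(p <- grandchildren a j) branch_vars (inl p.2) (inr p.1).
Proof.
move=> aN ja; have aj : incidence N (inl a) (inr j) by rewrite /= aN.
apply/setP => i; rewrite in_branch_vars finset.in_setU in_setD1.
apply/(branchP incidence_sym incidence_irr N_acyclic (inr i) aj)/orP.
  case=> [//|/andP[/andP[_ ia] ij]|[[[b|i'] [b'|i'']] ]]; first by left; rewrite ia andbT.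
  all: try by case/and4P.
  move=> g ib; right; apply/bigcup_seqP; exists (i', b').
    by rewrite mem_grandchildren.
  by rewrite inE.
case=> [/andP[ij ia]|/bigcup_seqP[p pg ip]].
  by constructor 2; rewrite /= aN ia.
constructor 3; exists (inr p.1, inl p.2); first by rewrite -mem_grandchildren.
by rewrite in_branch_vars in ip.
Qed.

Lemma branch_nodesE a j : a \in N -> j \in edges a -> branch_nodes (inl a) (inr j) =
  a |: \bigcup_(p <- grandchildren a j) branch_nodes (inl p.2) (inr p.1).
Proof.
move=> aN ja; have aj : incidence N (inl a) (inr j) by rewrite /= aN.
apply/setP => c; rewrite in_branch_nodes in_setU1.
apply/(branchP incidence_sym incidence_irr N_acyclic (inl c) aj)/orP.
  case=> [[->]|//|[[[b|i'] [b'|i'']] ]]; first by left.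
  all: try by case/and4P.
  move=> g ib; right; apply/bigcup_seqP; exists (i', b').
    by rewrite mem_grandchildren.
  by rewrite in_branch_nodes.
case=> [/eqP->|/bigcup_seqP[p pg ip]]; first by constructor 1.
constructor 3; exists (inr p.1, inl p.2); first by rewrite -mem_grandchildren.
by rewrite in_branch_nodes in ip.
Qed.

Lemma grandchildren_uniq a j : uniq (grandchildren a j).
Proof. by rewrite filter_uniq// enum_uniq. Qed.

Lemma branch_vars_disjoint (u v u' v' : (node Phi + X)%type) :
  [disjoint branch (incidence N) u v & branch (incidence N) u' v'] ->
  [disjoint branch_vars u v & branch_vars u' v'].
Proof.
move=> /pred0P uv; apply/pred0P => i.
by have := uv (inr i); rewrite /= !in_branch_vars.
Qed.

Lemma branch_nodes_disjoint (u v u' v' : (node Phi + X)%type) :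
  [disjoint branch (incidence N) u v & branch (incidence N) u' v'] ->
  [disjoint branch_nodes u v & branch_nodes u' v'].
Proof.
move=> /pred0P uv; apply/pred0P => i.
by have := uv (inl i); rewrite /= !in_branch_nodes.
Qed.

Lemma weight_bigcup (I : eqType) (s : seq I) (A : I -> {set node Phi}) x :
  uniq s -> {in s &, forall i k : I, i != k -> [disjoint A i & A k]} ->
  weight (\bigcup_(i <- s) A i) x = \prod_(i <- s) weight (A i) x.
Proof.
elim: s => [|i s IH]; first by rewrite !big_nil /weight big_set0.
rewrite /= => /andP[is_ us] dA; rewrite !big_cons -IH//; last first.
  by move=> k l ks ls; apply: dA; rewrite inE ?ks ?ls orbT.
rewrite /weight -bigU//=; first by apply: eq_bigl => c; rewrite finset.in_setU.
apply: bigcup_disjoint_seq => k ks; apply: dA; rewrite ?mem_head// ?inE ?ks ?orbT//.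
by apply: contraTneq ks => <-.
Qed.

Lemma grandchildP a j p : a \in N -> p \in grandchildren a j ->
  [/\ p.1 \in edges a, p.1 != j, p.2 \in N, p.1 \in edges p.2 & p.2 != a].
Proof.
move=> aN; rewrite mem_grandchildren// => /and4P[/= /andP[_ pa] pj /andP[pN pp] p2a].
by split.
Qed.

(** Induction on the size of the branch. On an acyclic graph the recursion is well founded, so it
    determines the messages out of nodes of [N]. *)
Lemma sum_productE (mu : messages Phi) : sum_product N mu ->
  forall a j (t : dom j), a \in N -> j \in edges a ->
  mu a j t = branch_mass a j (dfwith (data Phi) j t).
Proof.
move=> muN a j t; have [n] := ubnP #|branch (incidence N) (inl a) (inr j)|.
elim: n a j t => // n IH a j t /ltnSE le_n aN ja.
have gc p : p \in grandchildren a j -> grandchild (incidence N) (inl a) (inr j) (inr p.1, inl p.2).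
  by rewrite -mem_grandchildren.
have bdisj : {in grandchildren a j &, forall p q, p != q ->
    [disjoint branch (incidence N) (inl p.2) (inr p.1) &
              branch (incidence N) (inl q.2) (inr q.1)]}.
  move=> p q ps qs pq.
  apply: (grandchild_disjoint incidence_sym incidence_irr N_acyclic (gc _ ps) (gc _ qs)).
  apply: contraNneq pq => -[E1 E2].
  by rewrite [p]surjective_pairing E1 E2 -surjective_pairing.
have edgeB p i : p \in grandchildren a j -> i \in edges a ->
    i \notin branch_vars (inl p.2) (inr p.1).
  move=> ps ia; rewrite in_branch_vars.
  apply: (child_grandchild_notin incidence_sym incidence_irr N_acyclic (gc _ ps)).
  by rewrite /= aN.
rewrite muN// /branch_mass branch_varsE// branch_nodesE//.
rewrite integral_overU; last 2 first.
- apply: bigcup_disjoint_seq => p ps; apply/pred0P => i /=; apply/negP => /andP[/setDP[ia _]].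
  by apply/negP; exact: edgeB.
- exact: nonneg_measurable_weight.
apply: eq_integral_over => y yx.
have weightE z : weight (a |: \bigcup_(p <- grandchildren a j) branch_nodes (inl p.2) (inr p.1)) z =
    (fac a z)%:E * \prod_(p <- grandchildren a j) weight (branch_nodes (inl p.2) (inr p.1)) z.
  rewrite {1}/weight big_setU1//=; last first.
    apply/bigcup_seqP => -[p ps]; apply/negP; rewrite in_branch_nodes.
    exact: (grandchild_notin incidence_sym incidence_irr N_acyclic (gc _ ps)).
  congr (_ * _); apply: weight_bigcup; first exact: grandchildren_uniq.
  by move=> p q ps qs pq; apply: branch_nodes_disjoint; exact: bdisj.
rewrite (eq_integral_over (fun z _ => weightE z)) integral_overZl; last 3 first.
- by apply: nonneg_measurable_prod => p _; exact: nonneg_measurable_weight.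
- by move=> z; rewrite lee_fin fac_ge0.
- move=> z zy; congr _%:E; apply: fac_args => v va; apply: zy.
  apply/bigcup_seqP => -[p ps]; apply/negP.
  have [vo|vo] := boolP (v \in observed Phi); first exact: observed_branch.
  by apply: edgeB; rewrite // finset.in_setD vo.
(* A branch also depends on the edge [p.1] linking it to [a] and on the observations. Neither is
   integrated in any branch, so the factors separate. *)
rewrite (integral_over_prod (D := fun p => branch_vars (inl p.2) (inr p.1) :|: (p.1 |: observed Phi))); last 4 first.
- exact: grandchildren_uniq.
- by move=> p _; exact: nonneg_measurable_weight.
- by move=> p /(grandchildP aN)[_ _ pN _ _]; exact: depends_on_weight.
- move=> p q ps qs pq; have dpq := branch_vars_disjoint (bdisj _ _ ps qs pq); split=> //.
  apply/pred0P => v /=; apply/negP => /andP[vp]; rewrite finset.in_setU in_setU1 => /or3P[vq|/eqP vq|vo].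
  + by move/pred0P: dpq => /(_ v)/=; rewrite vp vq.
  + move: vp; apply/negP; apply: edgeB => //; rewrite vq.
    by have [] := grandchildP aN qs.
  + by move: vp; apply/negP; exact: observed_branch.
congr (_ * _); rewrite big_filter big_enum_cond/= (pair_big_dep _ _ _)/=.
apply: eq_big => [[i b]//|[i b] /= /and4P[ia bN ba ib]].
have [ij ie] := setD1P ia.
have ibe := edges_args ie ib.
have bis : (i, b) \in grandchildren a j by rewrite mem_filter/= ia bN ba ib mem_enum.
rewrite IH//; last first.
  (* The subtree is contained in the branch of [a] and misses [a] itself, so it is strictly
     smaller. *)
  apply: leq_trans le_n; apply: proper_card; apply/properP; split.
    apply/fintype.subsetP => z zb.
    apply/(branchP incidence_sym incidence_irr N_acyclic); first by rewrite /= aN.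
    by constructor 3; exists (inr i, inl b); first exact: (gc _ bis).
  exists (inl a); first exact: mem_branch.
  exact: (grandchild_notin incidence_sym incidence_irr N_acyclic (gc _ bis)).
(* The incoming message is evaluated on the data with coordinate [i] replaced by that of [y], the
   branch integral at [y]. Both agree on [i] and on the observations, all that the mass depends
   on. *)
apply: depends_on_branch_mass => // v; rewrite in_setU1 => /orP[/eqP->|vo].
  by rewrite dfwithin.
have iNv k : k \in edges a -> k != v by apply: contraTneq => ->; apply/negP => /setDP[_]; rewrite vo.
rewrite dfwithout ?iNv// yx ?dfwithout ?iNv//.
by apply/negP => /setD1P[_ /setDP[_]]; rewrite vo.
Qed.

Lemma sum_product_ge0 (mu : messages Phi) : sum_product N mu ->
  forall a j (t : dom j), a \in N -> j \in edges a -> 0 <= mu a j t.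
Proof.
move=> muN a j t aN ja; rewrite (sum_productE muN)//.
exact: (nonneg_measurable_branch_mass a j).2.
Qed.

Lemma mem_latent i : reflect (exists2 c, c \in N & i \in edges c) (i \in latent N).
Proof.
rewrite finset.in_setD; apply: (iffP andP) => [[io /bigcupP[c cN ic]]|[c cN /setDP[ic io]]].
  by exists c => //; apply/setDP.
by split=> //; apply/bigcupP; exists c.
Qed.

(** * Cutting a connected acyclic graph at a latent edge *)

Hypothesis N_connected : connected_graph N.

Lemma latent_connect_node j c : j \in latent N -> c \in N ->
  connect (incidence N) (inr j) (inl c).
Proof.
move=> /mem_latent[b bN jb] cN; apply: connect_trans (N_connected bN cN).
by apply: connect1; rewrite /= bN.
Qed.

Lemma latent_connect_var j i : j \in latent N -> i \in latent N ->
  connect (incidence N) (inr j) (inr i).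
Proof.
move=> jL /mem_latent[b bN ib]; apply: connect_trans (latent_connect_node jL bN) _.
by apply: connect1; rewrite /= bN.
Qed.

Definition end_nodes j : {set node Phi} := [set b in N | j \in args b].

Lemma mem_end_nodes j b : j \in latent N -> b \in end_nodes j = (b \in N) && (j \in edges b).
Proof.
by move=> /mem_latent[c _ /setDP[_ jo]]; rewrite finset.inE finset.in_setD jo.
Qed.

(** By connectedness every other latent variable is joined to [j], and the last step of a simple
    path to [j] comes from one of its end nodes. *)
Lemma latentD1E j : j \in latent N -> latent N :\ j =
  \bigcup_(b <- enum (end_nodes j)) branch_vars (inl b) (inr j).
Proof.
move=> jL; apply/setP => i; rewrite in_setD1; apply/andP/bigcup_seqP => [[ij iL]|[b]].
  have [] := connect_branch incidence_sym (latent_connect_var jL iL).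
    by rewrite (inj_eq inr_inj).
  case=> [b|//] /andP[bj _] ib; exists b; last by rewrite in_branch_vars.
  by rewrite mem_enum mem_end_nodes.
rewrite mem_enum mem_end_nodes// => /andP[bN jb] ib; split.
  rewrite in_branch_vars in ib; apply: contraTneq ib => ->.
  by rewrite branch_notin.
by apply/mem_latent; exact: branch_vars_edge ib.
Qed.

Lemma nodesE j : j \in latent N -> N =
  \bigcup_(b <- enum (end_nodes j)) branch_nodes (inl b) (inr j).
Proof.
move=> jL; apply/setP => c; apply/idP/bigcup_seqP => [cN|[b]].
  have [] // := connect_branch incidence_sym (latent_connect_node jL cN).
  case=> [b|//] /andP[bj _] ib; exists b; last by rewrite in_branch_nodes.
  by rewrite mem_enum mem_end_nodes.
by rewrite mem_enum mem_end_nodes// => /andP[bN jb]; apply/fintype.subsetP; exact: branch_nodes_sub.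
Qed.

(** The branches at the end nodes of [j] are disjoint and their factors share only [j] and the
    observations, so the integral splits into one message per end node. *)
Lemma edge_belief (mu : messages Phi) j (t : dom j) : sum_product N mu -> j \in latent N ->
  integral_over (latent N :\ j) (EFin \o joint N) (dfwith (data Phi) j t) =
  \prod_(b in end_nodes j) mu b j t.
Proof.
move=> muN jL.
have bdisj : {in enum (end_nodes j) &, forall b c, b != c ->
    [disjoint branch (incidence N) (inl b) (inr j) & branch (incidence N) (inl c) (inr j)]}.
  move=> b c; rewrite !mem_enum !mem_end_nodes// => /andP[bN jb] /andP[cN jc] bc.
  by apply: (branch_disjoint incidence_sym N_acyclic); rewrite //= ?bN ?cN.
rewrite joint_weight latentD1E// (congr1 weight (nodesE jL)).
have weightE z : weight (\bigcup_(b <- enum (end_nodes j)) branch_nodes (inl b) (inr j)) z =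
    \prod_(b <- enum (end_nodes j)) weight (branch_nodes (inl b) (inr j)) z.
  apply: weight_bigcup; first exact: enum_uniq.
  by move=> b c bs cs bc; apply: branch_nodes_disjoint; exact: bdisj.
rewrite (eq_integral_over (fun z _ => weightE z)).
rewrite (integral_over_prod (D := fun b => branch_vars (inl b) (inr j) :|: (j |: observed Phi))); last 4 first.
- exact: enum_uniq.
- by move=> b _; exact: nonneg_measurable_weight.
- by move=> b; rewrite mem_enum mem_end_nodes// => /andP[bN _]; exact: depends_on_weight.
- move=> b c bs cs bc; have dbc := branch_vars_disjoint (bdisj _ _ bs cs bc); split=> //.
  apply/pred0P => v /=; apply/negP => /andP[vp]; rewrite finset.in_setU in_setU1 => /or3P[vq|/eqP vq|vo].
  + by move/pred0P: dbc => /(_ v)/=; rewrite vp vq.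
  + by move: vp; apply/negP; rewrite vq in_branch_vars branch_notin.
  + by move: vp; apply/negP; exact: observed_branch.
rewrite big_enum/=; apply: eq_bigr => b; rewrite mem_end_nodes// => /andP[bN jb].
by rewrite (sum_productE muN).
Qed.

Lemma nonneg_measurable_joint : nonneg_measurable (EFin \o joint N).
Proof. by rewrite joint_weight; exact: nonneg_measurable_weight. Qed.

Lemma evidenceE (mu : messages Phi) j : sum_product N mu -> j \in latent N ->
  evidence N = \int[refm j]_t \prod_(b in end_nodes j) mu b j t.
Proof.
move=> muN jL; rewrite /evidence -(finset.setD1K jL) integral_overU.
- by rewrite integral_over1; apply: eq_integral => t _; rewrite -edge_belief.
- by rewrite disjoints1 in_setD1 eqxx.
- exact: nonneg_measurable_joint.
Qed.

End messages_on_trees.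

(** * Free energies *)

Section onehot_vectors.
Context (K : nat).

Lemma hot_inj : injective (@hot K).
Proof.
move=> k l /(congr1 (fun m : onehot K => m l)); rewrite !ffunE eqxx => /eqP/eqP H.
by apply/eqP; rewrite eq_sym; apply/idP.
Qed.

Lemma onehot_hot (m : onehot K) : exists k, m = hot k.
Proof.
have /eqP m1 := onehotP m.
have [k mk] : exists k, m k.
  apply/existsP; apply: contraT; rewrite negb_exists => /forallP m0.
  by move: m1; rewrite big1// => i _; rewrite (negbTE (m0 i)).
exists k; apply/val_inj/ffunP => i; rewrite ffunE.
have [->//|ik] := eqVneq i k.
apply: contraTF isT => mi; move: m1; rewrite (bigD1 k)//= (bigD1 i)//= mk mi.
by [].
Qed.

Lemma hot_bij : bijective (@hot K).
Proof.
apply: inj_card_bij; first exact: hot_inj.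
rewrite -(card_codom hot_inj); apply: subset_leq_card; apply/fintype.subsetP => m _.
by have [k ->] := onehot_hot m; exact: codom_f.
Qed.

Lemma sum_onehot (R : realType) (F : onehot K -> \bar R) :
  \sum_(m : onehot K) F m = \sum_(k < K) F (hot k).
Proof. by rewrite (reindex (@hot K))//; apply: onW_bij; exact: hot_bij. Qed.

Lemma prode_hot (R : realType) (F : 'I_K -> \bar R) k :
  \prod_(i < K) F i ^+ hot k i = F k.
Proof.
rewrite (bigD1 k)//= ffunE eqxx big1 ?mule1// => i ik.
by rewrite ffunE (negbTE ik) expe0.
Qed.

Lemma prodr_hot (R : realType) (F : 'I_K -> R) k :
  (\prod_(i < K) F i ^+ hot k i = F k)%R.
Proof.
rewrite (bigD1 k)//= ffunE eqxx expr1 big1 ?mulr1// => i ik.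
by rewrite ffunE (negbTE ik) expr0.
Qed.

Lemma bigcup_hot (T : finType) (A : 'I_K -> {set T}) k :
  \bigcup_(i < K | hot k i) A i = A k.
Proof.
rewrite (eq_bigl (pred1 k)) ?big_pred1_eq// => i.
by rewrite ffunE.
Qed.

End onehot_vectors.

(** * The integrand of relative entropy, with its conventions at zero *)

Section relative_entropy.
Context (R : realType).
Implicit Types p q r z : R.

Lemma qlnqp0 (p : \bar R) : qlnqp 0 p = 0.
Proof. by rewrite /qlnqp !mul0e. Qed.

Lemma qlnqpy q : (0 < q)%R -> qlnqp q%:E 0 = +oo.
Proof. by move=> q0; rewrite /qlnqp inve0 gt0_muley ?lte_fin//= gt0_muley ?lte_fin. Qed.

Lemma qlnqp_EFin p q : (0 <= q)%R -> (0 < p)%R -> qlnqp q%:E p%:E = (q * ln (q / p))%:E.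
Proof.
move=> q0 p0; have [->|qN0] := eqVneq q 0%R; first by rewrite qlnqp0 mul0r.
rewrite /qlnqp inver gt_eqF// -EFinM lne_EFin// divr_gt0// lt_def qN0//.
Qed.

(* Both arguments carry the density [r] of the exact posterior [r / z], so the
   logarithm no longer depends on the latent variables. *)
Lemma qlnqpM p q r z : (0 <= p)%R -> (0 <= q)%R -> (0 <= r)%R -> (0 < z)%R ->
  qlnqp (q * (r / z))%:E (p * r)%:E = (r / z)%:E * qlnqp q%:E (p%:E * z%:E).
Proof.
move=> p0 q0 r0 z0.
have [->|rN0] := eqVneq r 0%R; first by rewrite mul0r mulr0 qlnqp0 mul0e.
have [->|qN0] := eqVneq q 0%R; first by rewrite mul0r !qlnqp0 mule0.
have rp : (0 < r)%R by rewrite lt_def rN0.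
have qp : (0 < q)%R by rewrite lt_def qN0.
have rz : (0 < r / z)%R by rewrite divr_gt0.
(* With [p = 0] and positive posterior mass both sides are [+oo]. *)
have [->|pN0] := eqVneq p 0%R.
  rewrite mul0r mul0e (qlnqpy qp) (qlnqpy (mulr_gt0 qp rz)).
  by rewrite gt0_muley ?lte_fin.
have pp : (0 < p)%R by rewrite lt_def pN0.
rewrite -EFinM (qlnqp_EFin (ltW (mulr_gt0 qp rz)) (mulr_gt0 pp rp)).
rewrite (qlnqp_EFin q0 (mulr_gt0 pp z0)) -EFinM.
have -> : (q * (r / z) / (p * r) = q / (p * z))%R.
  by field; rewrite pN0 rN0 gt_eqF.
by congr _%:E; rewrite [RHS]mulrA [(r / z * q)%R]mulrC.
Qed.

End relative_entropy.

(** * Free energy at the exact posterior *)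

Section free_energies.
Context (R : realType) (X : variables R) (Phi : factors X) (N : {set node Phi}).
Hypothesis N_tractable : tractable N.

Lemma evidence_fine : evidence N = (fine (evidence N))%:E.
Proof. by rewrite fineK// gt0_fin_numE; case/andP: N_tractable. Qed.

Lemma fine_evidence_gt0 : (0 < fine (evidence N))%R.
Proof. exact: fine_gt0. Qed.

Lemma joint_ge0 x : (0 <= joint N x)%R.
Proof. by apply: prodr_ge0 => a _; exact: fac_ge0. Qed.

Lemma posterior_ge0 x : (0 <= posterior N x)%R.
Proof. by rewrite divr_ge0 ?joint_ge0// ltW// fine_evidence_gt0. Qed.

Lemma integral_over_posterior (S : {set X}) x :
  integral_over S (EFin \o posterior N) x =
  integral_over S (EFin \o joint N) x / evidence N.
Proof.
rewrite [in RHS]evidence_fine inver gt_eqF ?fine_evidence_gt0// muleC.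
pose c : asg X -> \bar R := cst (fine (evidence N))^-1%:E.
rewrite -(@integral_overZl _ _ S _ c)//; last 2 first.
- exact: nonneg_measurable_joint.
- by move=> y; rewrite lee_fin invr_ge0 ltW// fine_evidence_gt0.
by apply: eq_integral_over => y _; rewrite /c/= -EFinM mulrC.
Qed.

Lemma nonneg_measurable_posterior : nonneg_measurable (EFin \o posterior N).
Proof.
rewrite (_ : _ \o _ = fun x => (EFin \o joint N) x * (cst (fine (evidence N))^-1%:E : asg X -> _) x).
  apply: nonneg_measurableM; first exact: nonneg_measurable_joint.
  split=> [|x]; first exact: measurable_cst.
  by rewrite lee_fin invr_ge0 ltW// fine_evidence_gt0.
by apply/funext => x; rewrite /= -EFinM.
Qed.

(** The posterior integrates to one. As [c] may be negative or infinite, its positive and negative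
    parts are integrated separately; one of them is zero, so no indeterminate difference arises. *)
Lemma sintegral_posterior (c : \bar R) :
  sintegral_over (latent N) (fun x => (posterior N x)%:E * c) (data Phi) = c.
Proof.
have I1 (d : \bar R) : 0 <= d ->
    integral_over (latent N) (fun x => d * (EFin \o posterior N) x) (data Phi) = d.
  move=> d0; rewrite (integral_overZl (G := cst d))//; last first.
    exact: nonneg_measurable_posterior.
  rewrite integral_over_posterior -/(evidence N) evidence_fine inver gt_eqF ?fine_evidence_gt0//.
  by rewrite -EFinM divff ?mule1// gt_eqF// fine_evidence_gt0.
rewrite /sintegral_over.
rewrite (_ : _^\+ = fun x => maxe c 0 * (EFin \o posterior N) x); last first.
  apply/funext => x; rewrite funeposE [RHS]muleC maxe_pMr// ?mule0// lee_fin; exact: posterior_ge0.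
rewrite (_ : _^\- = fun x => maxe (- c) 0 * (EFin \o posterior N) x); last first.
  apply/funext => x; rewrite funenegE [RHS]muleC maxe_pMr// ?mule0 ?muleN// lee_fin; exact: posterior_ge0.
rewrite !I1 ?le_max ?lexx ?orbT//.
have [c0|c0] := leP 0 c.
  by rewrite (@max_idPr _ _ (- c) 0 _) ?sube0// oppe_le0.
by rewrite (@max_idPl _ _ (- c) 0 _) ?sub0e ?oppeK// oppe_ge0 ltW.
Qed.

Lemma expeR_free_energy : expeR (- free_energy N (posterior N)) = evidence N.
Proof.
(* This is [qlnqpM] with both weights equal to 1; the value is minus the logarithm of the
   evidence. *)
have -> : free_energy N (posterior N) = qlnqp 1 (1 * evidence N).
  rewrite -[RHS]sintegral_posterior; congr (sintegral_over _ _ _); apply/funext => x.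
  rewrite [in RHS]evidence_fine -qlnqpM ?ler01 ?joint_ge0 ?fine_evidence_gt0//.
  by rewrite !mul1r.
have e0 := fine_evidence_gt0.
rewrite mul1e [in LHS]evidence_fine qlnqp_EFin// !mul1r lnV//.
by rewrite -EFinN opprK /= lnK// -evidence_fine.
Qed.

End free_energies.

(** * Gibbs' inequality for unnormalized weights, with its equality case *)

Section gibbs.
Context (R : realType).
Implicit Types q w W : R.

Lemma ln_le_subr1 (y : R) : (0 < y)%R -> (ln y <= y - 1)%R.
Proof. by move=> y0; have := expR_ge1Dx (ln y); rewrite lnK//; lra. Qed.

Lemma ln_eq_subr1 (y : R) : (0 < y)%R -> (ln y = y - 1)%R -> y = 1%R.
Proof.
move=> y0 E; have [/eqP|l0] := eqVneq (ln y) 0%R; first by rewrite ln_eq0// => /eqP.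
by have := expR_gt1Dx l0; rewrite lnK// E; lra.
Qed.

(* the gap between [q ln (q / w)] and its tangent at [q = w / W] *)
Definition gibbs_gap q w W : R := (q * ln (q / w) + q * ln W - q + w / W)%R.

(** The gap is [q * (y - 1 - ln y)] at [y = w / (W * q)], so its sign and its zeros come from
    [ln y <= y - 1]. *)
Lemma gibbs_gapE q w W : (0 < q)%R -> (0 < w)%R -> (0 < W)%R ->
  gibbs_gap q w W = (q * (w / (W * q) - 1 - ln (w / (W * q))))%R.
Proof.
move=> q0 w0 W0; rewrite /gibbs_gap !ln_div ?lnM ?posrE ?mulr_gt0//.
by field; rewrite !gt_eqF.
Qed.

(** The last hypothesis excludes [q > 0] with [w = 0], where the real quotient [q / w] is 0 by
    convention while [qlnqp] is [+oo]. *)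
Lemma gibbs_gap_ge0 q w W : (0 <= q)%R -> (0 <= w)%R -> (0 < W)%R ->
  ((0 < q)%R -> (0 < w)%R) -> (0 <= gibbs_gap q w W)%R.
Proof.
move=> q0 w0 W0 qw; have [->|qN0] := eqVneq q 0%R.
  by rewrite /gibbs_gap !mul0r addr0 subr0 add0r divr_ge0// ltW.
have qp : (0 < q)%R by rewrite lt_def qN0.
have wp := qw qp; rewrite gibbs_gapE// mulr_ge0// subr_ge0.
by apply: ln_le_subr1; rewrite divr_gt0 ?mulr_gt0.
Qed.

Lemma gibbs_gap_eq0 q w W : (0 <= q)%R -> (0 <= w)%R -> (0 < W)%R ->
  ((0 < q)%R -> (0 < w)%R) -> gibbs_gap q w W = 0%R -> q = (w / W)%R.
Proof.
move=> q0 w0 W0 qw; have [->|qN0] := eqVneq q 0%R.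
  by rewrite /gibbs_gap !mul0r addr0 subr0 add0r.
have qp : (0 < q)%R by rewrite lt_def qN0.
have wp := qw qp; rewrite gibbs_gapE// => /eqP.
rewrite mulf_eq0 (negbTE qN0)/= subr_eq0 => /eqP/esym/ln_eq_subr1.
rewrite divr_gt0 ?mulr_gt0// => /(_ isT) E.
have : (w / (W * q) * q = q)%R by rewrite E mul1r.
by move<-; field; rewrite !gt_eqF.
Qed.

Context (I : finType) (w : I -> R).
Hypothesis w_ge0 : forall i, (0 <= w i)%R.
Let W : R := (\sum_i w i)%R.
Hypothesis W_gt0 : (0 < W)%R.

(** The terms [- q i] and [w i / W] sum to -1 and 1 and cancel. *)
Lemma sum_gibbs_gap (q : I -> R) : (\sum_i q i = 1)%R ->
  (\sum_i gibbs_gap (q i) (w i) W = \sum_i q i * ln (q i / w i) + ln W)%R.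
Proof.
move=> q1; rewrite /gibbs_gap !big_split/= -mulr_suml q1 mul1r.
by rewrite sumrN q1 -mulr_suml -/W divff ?gt_eqF// subrK.
Qed.

Lemma sum_qlnqp_real (q : I -> R) : (forall i, (0 <= q i)%R) ->
  (forall i, (0 < q i)%R -> (0 < w i)%R) ->
  \sum_i qlnqp (q i)%:E (w i)%:E = (\sum_i q i * ln (q i / w i))%:E.
Proof.
move=> q0 qw; rewrite -sumEFin; apply: eq_bigr => i _.
have [->|qN0] := eqVneq (q i) 0%R; first by rewrite qlnqp0 mul0r.
by rewrite qlnqp_EFin// qw// lt_def qN0 q0.
Qed.

Lemma sum_qlnqp_infty (q : I -> R) : (forall i, (0 <= q i)%R) ->
  (exists2 i, (0 < q i)%R & w i = 0%R) ->
  \sum_i qlnqp (q i)%:E (w i)%:E = +oo.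
Proof.
(* No term is [-oo], so a single infinite term decides the sum. *)
move=> q0 [i qi wi]; apply/eqP; rewrite esum_eqy.
  by apply/existsP; exists i; rewrite wi qlnqpy.
move=> k _; have [->|wN0] := eqVneq (w k) 0%R.
  have [->|qN0] := eqVneq (q k) 0%R; first by rewrite qlnqp0.
  by rewrite qlnqpy// lt_def qN0 q0.
by rewrite qlnqp_EFin// lt_def wN0 w_ge0.
Qed.

(** Either [q] is absolutely continuous with respect to [w] and all sums are real, or its divergence
    is [+oo] and [q] cannot be a minimizer. *)
Lemma support_dec (q : I -> R) : (forall i, (0 <= q i)%R) ->
  (forall i, (0 < q i)%R -> (0 < w i)%R) \/ (exists2 i, (0 < q i)%R & w i = 0%R).
Proof.
move=> q0; have [/existsP[i /andP[qi /eqP wi]]|] := boolP [exists i, (0 < q i)%R && (w i == 0%R)].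
  by right; exists i.
rewrite negb_exists => /forallP H; left => i qi; rewrite lt_def w_ge0 andbT.
by have := H i; rewrite qi.
Qed.

Lemma gibbs_inequality (q : I -> R) : (forall i, (0 <= q i)%R) -> (\sum_i q i = 1)%R ->
  (- ln W)%:E <= \sum_i qlnqp (q i)%:E (w i)%:E.
Proof.
move=> q0 q1; have [qw|qw] := support_dec q0; last by rewrite sum_qlnqp_infty ?leey.
rewrite sum_qlnqp_real// lee_fin.
have : (0 <= \sum_i gibbs_gap (q i) (w i) W)%R.
  by apply: sumr_ge0 => i _; apply: gibbs_gap_ge0 => //; exact: qw.
by rewrite sum_gibbs_gap//; lra.
Qed.

Lemma gibbs_minimum : \sum_i qlnqp (w i / W)%:E (w i)%:E = (- ln W)%:E.
Proof.
have wW i : (0 <= w i / W)%R by rewrite divr_ge0// ltW.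
rewrite sum_qlnqp_real// => [|i]; last by rewrite pmulr_lgt0 ?invr_gt0.
congr _%:E; transitivity (\sum_i (w i / W) * - ln W)%R.
  apply: eq_bigr => i _; have [->|wN0] := eqVneq (w i) 0%R; first by rewrite !mul0r.
  by congr (_ * _)%R; rewrite mulrAC divff// mul1r lnV.
by rewrite -!mulr_suml -/W divff ?mul1r// gt_eqF.
Qed.

(** At the minimum the nonnegative gaps sum to zero, so each vanishes. *)
Lemma gibbs_unique (q : I -> R) : (forall i, (0 <= q i)%R) -> (\sum_i q i = 1)%R ->
  \sum_i qlnqp (q i)%:E (w i)%:E <= (- ln W)%:E -> forall i, q i = (w i / W)%R.
Proof.
move=> q0 q1; have [qw|qw] := support_dec q0; last by rewrite sum_qlnqp_infty.
rewrite sum_qlnqp_real// lee_fin => le_q i.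
have g0 k : (0 <= gibbs_gap (q k) (w k) W)%R by apply: gibbs_gap_ge0 => //; exact: qw.
apply: gibbs_gap_eq0 => //; first exact: qw.
have /eqP : (\sum_i gibbs_gap (q i) (w i) W = 0)%R.
  apply/eqP; rewrite eq_le sumr_ge0// andbT.
  by rewrite sum_gibbs_gap//; lra.
by rewrite psumr_eq0// => /allP/(_ i (mem_index_enum _))/eqP.
Qed.

End gibbs.

(** * Mixtures *)

Section mixtures.
Context (R : realType) (X : variables R) (Phi : factors X) (K : nat).
Context (N : 'I_K -> {set node Phi}).
Hypothesis N_tractable : forall k, tractable (N k).

Lemma f_m_hot k : f_m N (hot k) = evidence (N k).
Proof. by rewrite /f_m prode_hot expeR_free_energy. Qed.

(** At a one-hot vector only the selected model remains. By [qlnqpM] its integrand is the posterior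
    times a constant, and the posterior integrates to one. *)
Lemma mixture_free_energyE (p q : onehot K -> R) :
  (forall m, (0 <= p m)%R) -> (forall m, (0 <= q m)%R) ->
  mixture_free_energy N p q =
  \sum_(m : onehot K) qlnqp (q m)%:E ((p m)%:E * f_m N m).
Proof.
move=> p0 q0; apply: eq_bigr => m _; have [k ->] := onehot_hot m.
have T := N_tractable k.
rewrite /selected_latent bigcup_hot f_m_hot -[RHS](sintegral_posterior T).
congr (sintegral_over _ _ _); apply/funext => x.
rewrite /mixture_q /mixture_joint !prodr_hot (evidence_fine T).
by apply: qlnqpM => //; [exact: joint_ge0|exact: fine_evidence_gt0].
Qed.

End mixtures.

(** * The two messages on an edge between two nodes *)

Section interface_edge.
Context (R : realType) (X : variables R) (Phi : factors X) (N : {set node Phi}).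
Context (mu : messages Phi) (j : X) (a b : node Phi).
Arguments mu : clear implicits.
Hypothesis N_tree : forney_tree N.
Hypothesis mu_sum_product : sum_product N mu.
Hypothesis jN : j \in latent N.
Hypotheses (aN : a \in N) (bN : b \in N) (aj : j \in args a) (bj : j \in args b).
Hypothesis ab : a != b.

(** The Forney condition allows at most two nodes on an edge, and [a] and [b] already account for
    both. *)
Lemma end_nodes2 : end_nodes N j = [set a; b].
Proof.
have [N_forney _ _] := N_tree.
apply/esym/eqP; rewrite eqEcard cards2 ab/= N_forney// andbT.
by apply/fintype.subsetP => c; rewrite finset.in_set2 => /orP[]/eqP->; rewrite finset.inE ?aN ?bN.
Qed.

Lemma prod_end_nodes2 (t : dom j) : \prod_(c in end_nodes N j) mu c j t = mu b j t * mu a j t.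
Proof.
by rewrite end_nodes2 big_setU1/= ?big_set1 ?finset.in_set1// muleC.
Qed.

Lemma evidence_edge : evidence N = \int[refm j]_t (mu b j t * mu a j t).
Proof.
have [_ cN acN] := N_tree.
by rewrite (evidenceE acN cN mu_sum_product jN); apply: eq_integral => t _; rewrite prod_end_nodes2.
Qed.

Lemma belief_edge (t : dom j) :
  integral_over (latent N :\ j) (EFin \o joint N) (dfwith (data Phi) j t) =
  mu b j t * mu a j t.
Proof.
have [_ cN acN] := N_tree.
by rewrite (edge_belief acN cN _ mu_sum_product jN) prod_end_nodes2.
Qed.

End interface_edge.

(** * Independence of a message from the model *)

Section shared_branch.
Context (R : realType) (X : variables R) (Phi : factors X).
Implicit Types N : {set node Phi}.

(** Every node met along a path in the first branch lies on the cut side, hence in [N2], so each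
    step is also an incidence of [N2]. *)
Lemma branch_subset N1 N2 j a : a \in N1 -> side N1 j a \subset N2 ->
  branch (incidence N1) (inl a) (inr j) \subset branch (incidence N2) (inl a) (inr j).
Proof.
move=> aN1 sN2; apply/fintype.subsetP => z; rewrite inE => /connectP[p + ->].
have sub c : inl c \in branch (incidence N1) (inl a) (inr j) -> c \in N2.
  by rewrite -in_branch_nodes -sideE//; exact: (fintype.subsetP sN2).
have : inl a \in branch (incidence N1) (inl a) (inr j) by exact: mem_branch.
have : inl a \in branch (incidence N2) (inl a) (inr j) by exact: mem_branch.
elim: p {1 3 5 6}(inl a : (node Phi + X)%type) => [//|v p IH] u uB2 uB1 /= /andP[/and3P[uv uj vj] vp].
have vB1 := branch_step uB1 uj uv vj.
apply: IH vp => //; apply: (branch_step uB2 uj _ vj).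
move: uv uB1 vB1 {uj vj uB2}; case: u v => [c|i] [d|i'] //=.
- by move=> /andP[_ ->] /sub->.
- by move=> /andP[_ ->] _ /sub->.
Qed.

(** By [sum_productE] a message depends on the model only through the branch behind it, and the two
    inclusions make the branches equal. *)
Lemma shared_message N1 N2 mu1 mu2 j a (t : dom j) :
  acyclic N1 -> acyclic N2 -> sum_product N1 mu1 -> sum_product N2 mu2 ->
  a \in N1 -> a \in N2 -> j \in edges a ->
  side N1 j a \subset N2 -> side N2 j a \subset N1 -> mu1 a j t = mu2 a j t.
Proof.
move=> ac1 ac2 s1 s2 a1 a2 ja s12 s21.
rewrite (sum_productE ac1 s1)// (sum_productE ac2 s2)// /branch_mass.
have E : branch (incidence N1) (inl a) (inr j) = branch (incidence N2) (inl a) (inr j).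
  by apply/eqP; rewrite finset.eqEsubset !branch_subset.
by rewrite /branch_vars /branch_nodes E.
Qed.

End shared_branch.

(** * The message of the prior graph as a positive multiple of [p(m)] *)

Section prior_message.
Context (R : realType) (n : nat) (W : variables R) (Psi : factors (prior_variables n W)).
Context (am : node Psi) (nu : messages Psi).
Arguments nu : clear implicits.
Hypothesis Psi_prior : prior_graph am.
Hypothesis nu_sum_product : sum_product [set: node Psi] nu.

(** The variable [m] is a half-edge with [am] as its only end node, so the product of messages on it
    has a single factor. *)
Lemma prior_massE (m : onehot n.+1) : prior_mass Psi m = nu am (mvar n W) m.
Proof.
have [[_ cN acN] mo am_m _] := Psi_prior.
have mL : mvar n W \in latent [set: node Psi].
  apply/mem_latent; exists am => //; apply/setDP; split=> //.
  by rewrite am_m.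
rewrite /prior_mass (@edge_belief _ _ _ _ acN cN nu (mvar n W) m)//.
rewrite (_ : end_nodes _ _ = [set am]) ?big_set1//.
by apply/setP => c; rewrite finset.in_set1 finset.inE am_m finset.in_setT.
Qed.

Lemma prior_mass_ge0 (m : onehot n.+1) : 0 <= prior_mass Psi m.
Proof.
exact: (nonneg_measurable_integral_over _ (nonneg_measurable_joint _)).2.
Qed.

Lemma prior_mass_fin (m : onehot n.+1) : prior_mass Psi m \is a fin_num.
Proof.
have [_ _ _ /andP[_ sy]] := Psi_prior.
rewrite ge0_fin_numE ?prior_mass_ge0//; apply: le_lt_trans sy.
rewrite (bigD1 m)//= leeDl// sume_ge0// => i _; exact: prior_mass_ge0.
Qed.

Definition prior_total : R := \sum_(m : onehot n.+1) fine (prior_mass Psi m).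

Lemma prior_total_gt0 : (0 < prior_total)%R.
Proof.
have [_ _ _ /andP[s0 _]] := Psi_prior.
rewrite -lte_fin /prior_total -sumEFin.
by under eq_bigr do rewrite fineK ?prior_mass_fin//.
Qed.

Lemma prior_messageE (m : onehot n.+1) :
  nu am (mvar n W) m = (prior_total * prior_pmf Psi m)%:E.
Proof.
rewrite -prior_massE /prior_pmf -/prior_total mulrC divfK ?gt_eqF ?prior_total_gt0//.
by rewrite fineK// prior_mass_fin.
Qed.

Lemma prior_pmf_ge0 (m : onehot n.+1) : (0 <= prior_pmf Psi m)%R.
Proof. by rewrite divr_ge0 ?fine_ge0 ?prior_mass_ge0// ltW// prior_total_gt0. Qed.

Lemma sum_prior_pmf : (\sum_(m : onehot n.+1) prior_pmf Psi m = 1)%R.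
Proof. by rewrite -mulr_suml divff// gt_eqF// prior_total_gt0. Qed.

End prior_message.

(** * Outgoing messages of the mixture node and the posteriors they give *)

Local Open Scope classical_set_scope.
Local Open Scope ring_scope.
Local Open Scope ereal_scope.

Theorem mainTheorem4 (R : realType) (n : nat)
    (* the K = n.+1 models, each with its sum-product messages *)
    (X : variables R) (Phi : factors X) (N : 'I_n.+1 -> {set node Phi})
    (mu : 'I_n.+1 -> messages Phi)
    (N_normalized : forall k, normalized (N k))
    (N_tree : forall k, forney_tree (N k))
    (N_tractable : forall k, tractable (N k))
    (mu_sum_product : forall k, sum_product (N k) (mu k))
    (* s_j connects the overlapping factor a0 to the non-overlapping b k *)
    (j : X) (a0 : node Phi) (b : 'I_n.+1 -> node Phi)
    (j_overlap : j \in overlapping_latent N)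
    (a0_overlap : a0 \in overlapping_factors N)
    (a0_j : j \in args a0)
    (b_non_overlap : forall k, b k \in N k :\: overlapping_factors N)
    (b_j : forall k, j \in args (b k))
    (* the graph of p(m), with its sum-product messages *)
    (W : variables R) (Psi : factors (prior_variables n W)) (am : node Psi)
    (nu : messages Psi)
    (Psi_prior : prior_graph am)
    (nu_sum_product : sum_product [set: node Psi] nu) :
  let mum (m : onehot n.+1) := nu am (mvar n W) m in
  let fwd k := mu k (b k) j in
  let bwd k := mu k a0 j in
  let p := prior_pmf Psi in
  (* the backward message does not depend on the model as soon as everything
     behind s_j is overlapping *)
  ((forall k, side (N k) j a0 \subset overlapping_factors N) ->
   forall k l t, bwd k t = bwd l t) /\
  forall bwd0 : dom j -> \bar R, (forall k t, bwd k t = bwd0 t) ->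
  let out_m := mixture_to_m fwd bwd0 in
  let out_s := mixture_to_s mum fwd in
  let out_model := mixture_to_model bwd0 in
  let Z := \sum_(k < n.+1) mum (hot k) * out_m (hot k) in
  [/\ (forall k t, bwd k t = out_model k t),
      (* (i) *)
      (forall k, expeR (- free_energy (N k) (posterior (N k))) =
                 \int[refm j]_t (fwd k t * bwd k t)),
      (forall m, out_m m = f_m N m),
      (forall q, distribution_m q ->
         mixture_free_energy N p q =
         \sum_(m : onehot n.+1) qlnqp (q m)%:E ((p m)%:E * f_m N m)) &
      [/\ 0 < Z < +oo,
          (exists q, optimal_q N p q),
          (forall q, optimal_q N p q ->
             (forall m, Z * (q m)%:E = mum m * out_m m) /\
             (forall m, mum m * out_m m = mum m * f_m N m)),
          (* (ii) *)
          (forall k t, posterior_marginal (N k) t =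
             fwd k t * bwd k t / \int[refm j]_u (fwd k u * bwd k u)) &
          (forall q, optimal_q N p q -> forall t : dom j,
             Z * mixture_marginal N q t =
               (\sum_(k < n.+1) mum (hot k) * fwd k t) * bwd0 t /\
             Z * mixture_marginal N q t = out_s t * bwd0 t)]].
Proof.
move=> mum fwd bwd p.
have jL k : j \in latent (N k) by exact: (bigcapP j_overlap).
have a0N k : a0 \in N k by exact: (bigcapP a0_overlap).
have bN k : b k \in N k by have /setDP[] := b_non_overlap k.
have ab k : a0 != b k.
  have /setDP[_] := b_non_overlap k; apply: contraNneq => <-.
  exact: a0_overlap.
have ja : j \in edges a0.
  by apply/setDP; split=> //; have /setDP[] := jL ord0.
have acN k : acyclic (N k) by have [] := N_tree k.
split.
  move=> side_sub k l t; apply: (shared_message t (acN k) (acN l)) => //.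
  - by apply: fintype.subset_trans (side_sub k) _; exact: (finset.bigcap_inf l).
  - by apply: fintype.subset_trans (side_sub l) _; exact: (finset.bigcap_inf k).
move=> bwd0 bwdE out_m out_s out_model Z.
pose z k := fine (evidence (N k)).
have zE k : evidence (N k) = (z k)%:E by exact: evidence_fine.
have z0 k : (0 < z k)%R by exact: fine_evidence_gt0.
have evE k : evidence (N k) = \int[refm j]_t (fwd k t * bwd k t).
  exact: (evidence_edge (N_tree k) (mu_sum_product k)).
have out_mE k : out_m (hot k) = (z k)%:E.
  rewrite /out_m /mixture_to_m prode_hot -zE evE.
  by apply: eq_integral => t _; rewrite bwdE.
have f_mE k : f_m N (hot k) = (z k)%:E by rewrite f_m_hot.
have out_f m : out_m m = f_m N m by have [k ->] := onehot_hot m; rewrite out_mE f_mE.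
pose S := prior_total Psi.
have S0 : (0 < S)%R by exact: prior_total_gt0 Psi_prior.
have mumE m : mum m = (S * p m)%:E by exact: prior_messageE.
have p0 m : (0 <= p m)%R by exact: prior_pmf_ge0 Psi_prior m.
have p1 : (\sum_m p m = 1)%R by exact: sum_prior_pmf Psi_prior.
(* The unnormalized posterior of [m]; the minimizer of the free energy will be [w / V]. *)
pose w (m : onehot n.+1) : R := (p m * fine (f_m N m))%R.
have f_fin m : f_m N m = (fine (f_m N m))%:E.
  by have [k ->] := onehot_hot m; rewrite f_mE.
have f0 m : (0 < fine (f_m N m))%R by have [k ->] := onehot_hot m; rewrite f_mE; exact: z0.

have w0 m : (0 <= w m)%R by rewrite mulr_ge0// ltW.
pose V : R := (\sum_m w m)%R.
have V0 : (0 < V)%R.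
  (* Every [f_m] is positive, so [V = 0] would force [p] to vanish everywhere, although it sums to
     one. *)
  rewrite lt_def sumr_ge0// andbT; apply/negP; rewrite psumr_eq0// => /allP V0.
  move/eqP: p1; apply/negP; rewrite big1 1?eq_sym ?oner_eq0// => m _.
  have := V0 m (mem_index_enum _); rewrite mulf_eq0 [X in _ || X]gt_eqF// orbF => /eqP.
  exact.
(* The prior message is [S] times [p], so [S] appears both in [Z] and in the products of messages,
   and [Z] times [w / V] is [S] times [w]. *)
have ZE : Z = (S * V)%:E.
  rewrite /Z -(sum_onehot (fun m => mum m * out_m m)) /V mulr_sumr -sumEFin.
  by apply: eq_bigr => m _; rewrite mumE out_f f_fin -EFinM /w mulrA.
have FE q : distribution_m q -> mixture_free_energy N p q =
    \sum_(m : onehot n.+1) qlnqp (q m)%:E (w m)%:E.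
  move=> [q0 _]; rewrite mixture_free_energyE//; apply: eq_bigr => m _.
  by rewrite f_fin -EFinM.
have qstar : distribution_m (fun m => (w m / V)%R).
  split=> [m|]; first by rewrite divr_ge0// ltW.
  by rewrite -mulr_suml divff// gt_eqF.
(* An optimal [q] does at least as well as [w / V], which attains the Gibbs bound, so the equality
   case identifies the two. *)
have optE q : optimal_q N p q -> forall m, Z * (q m)%:E = mum m * out_m m.
  move=> [dq opt] m; have [q0 q1] := dq.
  have := opt _ qstar; rewrite !FE// gibbs_minimum// => /(gibbs_unique w0 V0 q0 q1) ->.
  rewrite ZE mumE out_f f_fin -!EFinM; congr _%:E.
  by rewrite -/V /w; field; rewrite gt_eqF.
have beliefE k t : posterior_marginal (N k) t =
    fwd k t * bwd k t / \int[refm j]_u (fwd k u * bwd k u).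
  rewrite /posterior_marginal integral_over_posterior// -evE; congr (_ / _).
  exact: (belief_edge (N_tree k) (mu_sum_product k)).
have margE q : optimal_q N p q -> forall t : dom j,
    Z * mixture_marginal N q t = (\sum_(k < n.+1) mum (hot k) * fwd k t) * bwd0 t.
  move=> optq t; have [[q0 _] _] := optq.
  (* Nonnegativity of all terms is what makes multiplication distribute over sums of extended
     reals. *)
  have post0 k : 0 <= posterior_marginal (N k) t.
    exact: (nonneg_measurable_integral_over _ (nonneg_measurable_posterior (N_tractable k))).2.
  have fwd0 k : 0 <= fwd k t.
    apply: (sum_product_ge0 (acN k) (mu_sum_product k) t (bN k)).
    by apply/setDP; split=> //; have /setDP[] := jL k.
  have mum0 m : 0 <= mum m by rewrite mumE lee_fin mulr_ge0// ltW.
  rewrite [RHS]ge0_sume_distrl => [|k _]; last by rewrite mule_ge0.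
  rewrite /mixture_marginal sum_onehot ge0_sume_distrr; last first.
    by move=> k _; rewrite prode_hot mule_ge0// lee_fin.
  apply: eq_bigr => k _; rewrite prode_hot muleA optE// out_mE beliefE -evE zE bwdE.
  (* The evidence carried by the message to [m] cancels the normalization of the posterior marginal
     in each model. *)
  have zN0 : (z k)%:E != 0 by rewrite eqe gt_eqF.
  by rewrite -!muleA; congr (_ * _); rewrite muleC -!muleA mulVe// mule1.
split=> //.
- by move=> k; rewrite expeR_free_energy.
- by move=> q [q0 _]; exact: mixture_free_energyE.
split=> //.
- by rewrite ZE lte_fin mulr_gt0//= ltry.
- exists (fun m => (w m / V)%R); split=> // q' dq'.
  by rewrite !FE// gibbs_minimum//; apply: gibbs_inequality; have [] := dq'.
- move=> q optq; split=> m; first exact: optE.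
  by rewrite out_f.
- by move=> q optq t; split; exact: margE.
Qed.
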